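(* Let $\gamma_{n+1}=\gamma_n+hV_n$, $n\ge0$, with $h>0$, where $(V_n)_{n\ge0}$ follows Model 1 or Model 2 of the context. Then the $\beta$-mixing coefficients $\beta_{\mathrm{Frac}(\gamma)}(k)$ of the sequence $(\mathrm{Frac}(\gamma_n))_n$ converge to $0$ exponentially fast as $k\to\infty$.
   Context: $\mathrm{Frac}(x)=x-\lfloor x\rfloor$ is the fractional part. Let $0<v_{\min}<v_{\max}$ and $I=[v_{\min},v_{\max}]$. $(V_n)_{n\ge0}$ is a sequence of random variables in $I$, independent of $\gamma_0$. Model 1: the $V_n$ are i.i.d. with a law on $(0,\infty)$ such that there are $0<a<b$ and $c>0$ with $P(V_n\in A)\ge c\,\mathrm{Leb}(A)$ for all Borel $A\subset(a,b)$. Model 2: $(V_n)$ is a Markov chain on $I$ with transition kernel $P(v,\cdot)$ having a density $f_v$ with respect to Lebesgue measure, such that there are $\eta,\mu_0>0$ with $f_v\ge\mu_0$ on $[v-\eta,v+\eta]\cap I$ for all $v\in I$, and $v\mapsto f_v(x)$ is continuous for each $x\in I$. For a stationary sequence $(Z_n)$ (extended to $n\in\mathbb{Z}$), with $\sigma_{a,b}$ the $\sigma$-algebra generated by $Z_a,\dots,Z_b$, the $\beta$-mixing coefficients are $$\beta_Z(k)=\tfrac12\sup\sum_{A\in\mathcal{A},B\in\mathcal{B}}|P(A\cap B)-P(A)P(B)|,$$ the sup being over countable measurable partitions $\mathcal{A}\subset\sigma_{-\infty,0}$ and $\mathcal{B}\subset\sigma_{k,\infty}$ of the sample space. *)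

(* Defs.v *)
From HB Require Import structures.
From mathcomp Require Import all_boot all_order all_algebra finmap.
From mathcomp Require Import all_classical all_reals all_analysis.

Set Implicit Arguments.
Unset Strict Implicit.
Unset Printing Implicit Defensive.

Import Order.TTheory GRing.Theory Num.Theory.
Import numFieldNormedType.Exports.

Local Open Scope classical_set_scope.
Local Open Scope ring_scope.

Definition frac_part (R : realType) (x : R) : R := x - (Num.floor x)%:~R.

(* sigma-algebra generated by the real-valued functions X j, j in J *)
Definition sigma_gen (R : realType) (aT I : Type) (X : I -> aT -> R)
    (J : set I) : set (set aT) :=
  <<s \bigcup_(j in J)
        preimage_set_system setT (X j) (@measurable _ (measurableTypeR R)) >>.

(* product sigma-algebra on R^I *)
Definition cylinder_sigma (R : realType) (I : Type) : set (set (I -> R)) :=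
  sigma_gen (fun i (x : I -> R) => x i) setT.

Definition path_event (R : realType) (aT I : Type) (X : I -> aT -> R)
    (A : set (I -> R)) : set aT :=
  [set w | A (fun i => X i w)].

Definition same_law (R : realType) (d d' : measure_display)
    (T : measurableType d) (T' : measurableType d')
    (P : probability T R) (P' : probability T' R) (I : Type)
    (X : I -> T -> R) (Y : I -> T' -> R) : Prop :=
  forall A : set (I -> R), cylinder_sigma A ->
    P (path_event X A) = P' (path_event Y A).

Definition stationary (R : realType) (d : measure_display)
    (T : measurableType d) (P : probability T R) (Z : int -> T -> R) : Prop :=
  forall m : int, same_law P P (fun n => Z (n + m)) Z.

Definition indep_of_process (R : realType) (d : measure_display)
    (T : measurableType d) (P : probability T R) (I : Type)
    (X : T -> R) (Y : I -> T -> R) : Prop :=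
  forall (B : set (measurableTypeR R)) (A : set (I -> R)),
    measurable B -> cylinder_sigma A ->
    P (X @^-1` B `&` path_event Y A) = (P (X @^-1` B) * P (path_event Y A))%E.

Definition mutually_independent (R : realType) (d : measure_display)
    (T : measurableType d) (P : probability T R) (V : nat -> T -> R) : Prop :=
  forall (J : {fset nat}) (B : nat -> set (measurableTypeR R)),
    (forall i, measurable (B i)) ->
    P (\bigcap_(i in [set` J]) (V i @^-1` B i)) =
      (\prod_(i <- J) P (V i @^-1` B i))%E.

Definition model1 (R : realType) (d : measure_display) (T : measurableType d)
    (P : probability T R) (V : nat -> {RV P >-> R}) : Prop :=
  [/\ mutually_independent P V,
      (forall n (A : set (measurableTypeR R)), measurable A ->
         distribution P (V n) A = distribution P (V 0%N) A),
      distribution P (V 0%N) `]0, +oo[ = 1%E &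
      exists a b c : R, [/\ 0 < a, a < b, 0 < c &
        forall A : set (measurableTypeR R), measurable A -> A `<=` `]a, b[ ->
          (c%:E * lebesgue_measure A <= distribution P (V 0%N) A)%E]].

(* P(V_(n+1) \in A | V_0, ..., V_n) = K (V_n, A), with the conditional
   probability characterised by its integrals over sigma(V_0, ..., V_n) *)
Definition markov_chain (R : realType) (d : measure_display)
    (T : measurableType d) (P : probability T R) (V : nat -> T -> R)
    (K : R.-pker (measurableTypeR R) ~> (measurableTypeR R)) : Prop :=
  forall (n : nat) (A : set (measurableTypeR R)) (E : set T),
    measurable A -> sigma_gen V `I_n.+1 E ->
    P (E `&` V n.+1 @^-1` A) = (\int[P]_(w in E) K (V n w) A)%E.

(* The chain lives on I = [vmin, vmax]; K is given on all of R but only its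
   restriction to I, where it has the density f v carried by I, matters. *)
Definition model2 (R : realType) (d : measure_display) (T : measurableType d)
    (P : probability T R) (vmin vmax : R) (V : nat -> {RV P >-> R}) : Prop :=
  (forall n w, V n w \in `[vmin, vmax]) /\
  exists (K : R.-pker (measurableTypeR R) ~> (measurableTypeR R))
         (f : R -> R -> R),
    [/\ markov_chain P V K,
        (forall v, v \in `[vmin, vmax] ->
           [/\ measurable_fun `[vmin, vmax] (f v),
               (forall x, x \in `[vmin, vmax] -> 0 <= f v x) &
               forall A : set (measurableTypeR R), measurable A ->
                 K v A = (\int[lebesgue_measure]_(x in A `&` `[vmin, vmax])
                            (f v x)%:E)%E]),
        (exists eta mu0 : R, [/\ 0 < eta, 0 < mu0 &
           forall v x, v \in `[vmin, vmax] -> x \in `[vmin, vmax] ->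
             x \in `[v - eta, v + eta] -> mu0 <= f v x]) &
        forall x, x \in `[vmin, vmax] ->
          {within `[vmin, vmax], continuous (fun v => f v x)}].

(* Countable partition with blocks in S; finite partitions are included since
   blocks may be empty, and empty blocks do not contribute to beta_mixing. *)
Definition measurable_partition (T : Type) (S : set (set T))
    (A : nat -> set T) : Prop :=
  [/\ forall i, S (A i), trivIset setT A & \bigcup_i A i = setT].

Definition beta_mixing (R : realType) (d : measure_display)
    (T : measurableType d) (P : probability T R) (Z : int -> T -> R)
    (k : nat) : \bar R :=
  ((2^-1)%:E * ereal_sup [set s | exists A B : nat -> set T,
     [/\ measurable_partition (sigma_gen Z [set j : int | (j <= 0)%R]) A,
         measurable_partition (sigma_gen Z [set j : int | (k%:Z <= j)%R]) B &
         s = \sum_(0 <= i <oo) \sum_(0 <= j <oo)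
               `| P (A i `&` B j) - P (A i) * P (B j) |]])%E.

(* Main.v *)
Require Import Defs.
From HB Require Import structures.
From mathcomp Require Import all_boot all_order all_algebra finmap.
From mathcomp Require Import all_classical all_reals all_analysis.
From mathcomp Require Import measurable_realfun ring lra zify.

Set Implicit Arguments.
Unset Strict Implicit.
Unset Printing Implicit Defensive.

Import Order.TTheory GRing.Theory Num.Theory.
Import numFieldNormedType.Exports.

Local Open Scope classical_set_scope.
Local Open Scope ring_scope.

(** The past of the walk up to time m >= 1 is governed by the state
    (X_m, V_(m-1)), where X_n = gamma_n / h, so that X_(n+1) = X_n + V_n and
    Frac(gamma_n) is a periodic function of X_n; the V_n form a Markov chain in
    both models. The one-step operator of this chain of states is
    L f (x, v) = int K(v, dy) f (x + y, y). In both models there is an interval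
    J = ]a, b[ on which K(v, .) dominates a multiple of Lebesgue measure for
    every v in J, and which is reached from everywhere in M steps with
    probability bounded below. Convolving uniform steps on J spreads over a
    whole period, so on periodic functions some power L^N satisfies a Doeblin
    minorization, and L^k contracts oscillations exponentially fast. The
    conditional probability of a future event given the past is a periodic
    function f of the current state, and delaying the event by k steps replaces
    f by L^k f; hence |P(A B) - P(A) P(B)| <= C r^k P(A) for A in the past and B
    in the future. Stationarity of Z shifts a finite past to nonnegative times,
    and a monotone class argument reaches the infinite past. Summing over the
    blocks of two partitions bounds beta(k). *)

(** * Sigma-algebras generated by a process *)

Lemma pi_dynkin_sub (T : Type) (G H : set (set T)) :
  setI_closed G -> dynkin H -> G `<=` H -> <<s G >> `<=` H.
Proof.
by move=> GI dH GH; rewrite -setI_closed_g_dynkin_g_sigma_algebra//; exact: smallest_sub.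
Qed.

Lemma sigma_algebra_bigcap (T : Type) (S : set (set T)) (F : nat -> set T) :
  sigma_algebra setT S -> (forall i, S (F i)) -> S (\bigcap_i F i).
Proof.
move=> [_ SC SU] SF; rewrite -(setCK (\bigcap_i F i)) setC_bigcap -setTD.
by apply: (SC); apply: SU => i; rewrite -setTD; exact: SC.
Qed.

Lemma sigma_algebraT (T : Type) (S : set (set T)) :
  sigma_algebra setT S -> S setT.
Proof. by move=> [S0 SC _]; rewrite -(setD0 setT); exact: SC. Qed.

Lemma sigma_algebraI (T : Type) (S : set (set T)) (A B : set T) :
  sigma_algebra setT S -> S A -> S B -> S (A `&` B).
Proof.
move=> sS SA SB; rewrite -bigcap2E.
by apply: sigma_algebra_bigcap => // -[|[|n]] //=; exact: sigma_algebraT.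
Qed.

Section sigma_gen.
Context (R : realType) (aT I : Type).
Implicit Types (X : I -> aT -> R) (J : set I).

Lemma sigma_gen_sigma_algebra X J : sigma_algebra setT (sigma_gen X J).
Proof. exact: smallest_sigma_algebra. Qed.

Lemma sigma_gen_preimage X J j (B : set (measurableTypeR R)) :
  J j -> measurable B -> sigma_gen X J (X j @^-1` B).
Proof.
move=> Jj mB; apply: sub_sigma_algebra; exists j => //.
by exists B => //; rewrite setTI.
Qed.

Lemma sigma_gen_setT X J : sigma_gen X J setT.
Proof. exact: sigma_algebraT (sigma_gen_sigma_algebra X J). Qed.

Lemma sigma_gen_setI X J A B : sigma_gen X J A -> sigma_gen X J B ->
  sigma_gen X J (A `&` B).
Proof. exact: sigma_algebraI (sigma_gen_sigma_algebra X J). Qed.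

Lemma sigma_gen_sub X J (S : set (set aT)) : sigma_algebra setT S ->
  (forall j (B : set (measurableTypeR R)), J j -> measurable B -> S (X j @^-1` B)) ->
  sigma_gen X J `<=` S.
Proof.
move=> sS h; apply: smallest_sub => // _ [j Jj [B mB <-]].
by rewrite setTI; exact: h.
Qed.

Lemma sigma_gen_mono X J J' : J `<=` J' -> sigma_gen X J `<=` sigma_gen X J'.
Proof.
move=> JJ'; apply: sigma_gen_sub => [|j B Jj mB]; first exact: sigma_gen_sigma_algebra.
by apply: sigma_gen_preimage => //; exact: JJ'.
Qed.

End sigma_gen.

Section path_event.
Context (R : realType) (aT I : Type).
Implicit Types (X : I -> aT -> R) (J : set I).

(** Preimages of sets of paths form a sigma-algebra containing the generators. This is what carries
    an event of one process over to another process with the same law. *)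
Lemma sigma_gen_path_event X J (E : set aT) : sigma_gen X J E ->
  exists2 A, sigma_gen (fun i (x : I -> R) => x i) J A & E = path_event X A.
Proof.
pose S := [set E | exists2 A, sigma_gen (fun i (x : I -> R) => x i) J A & E = path_event X A].
have [P0 PC PU] := sigma_gen_sigma_algebra (fun i (x : I -> R) => x i) J.
apply: (@sigma_gen_sub _ _ _ X J S); first split.
- by exists set0.
- move=> _ [A SA ->]; exists (setT `\` A); first exact: PC.
  by rewrite !setTD.
- move=> F SF; pose G n := sval (cid2 (SF n)).
  exists (\bigcup_n G n).
    by apply: PU => n; rewrite /G; case: cid2.
  apply/seteqP; split => w [n _].
    by rewrite (svalP (cid2 (SF n))).2; exists n.
  move=> GA; exists n => //.
  by rewrite (svalP (cid2 (SF n))).2.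
move=> j B Jj mB; exists ((fun x : I -> R => x j) @^-1` B) => //.
by apply: sub_sigma_algebra; exists j => //; exists B => //; rewrite setTI.
Qed.

Lemma path_event_sigma_gen X J A :
  sigma_gen (fun i (x : I -> R) => x i) J A -> sigma_gen X J (path_event X A).
Proof.
have [P0 PC PU] := sigma_gen_sigma_algebra X J.
apply: (@sigma_gen_sub _ _ _ _ J [set A | sigma_gen X J (path_event X A)]); first split.
- exact: P0.
- by move=> B /= /PC; rewrite !setTD.
- by move=> F /= /PU.
- by move=> j B Jj mB; exact: sigma_gen_preimage.
Qed.

Lemma sigma_gen_cylinder J A :
  sigma_gen (fun i (x : I -> R) => x i) J A -> cylinder_sigma A.
Proof. exact: sigma_gen_mono. Qed.

End path_event.

Lemma sigma_gen_measurable (R : realType) d (T : measurableType d) (I : Type)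
    (X : I -> T -> R) (J : set I) : (forall j, J j -> measurable_fun setT (X j)) ->
  sigma_gen X J `<=` measurable.
Proof.
move=> mX; apply: sigma_gen_sub => [|j B Jj mB]; first exact: sigma_algebra_measurable.
by rewrite -(setTI (_ @^-1` _)); exact: mX.
Qed.

Lemma sigma_gen_reindex (R : realType) (aT I I' : Type) (X : I -> aT -> R)
    (Y : I' -> aT -> R) (J : set I) (J' : set I') :
  (forall j, J j -> exists2 i, J' i & X j = Y i) -> sigma_gen X J `<=` sigma_gen Y J'.
Proof.
move=> XY; apply: sigma_gen_sub => [|j B Jj mB]; first exact: sigma_gen_sigma_algebra.
by have [i Ji ->] := XY _ Jj; exact: sigma_gen_preimage.
Qed.

(** The bound [n] leaves finitely many effective constraints even when [J] is infinite. These sets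
    form a pi-system generating [sigma_gen X J]. *)
Definition rectangle (R : realType) (aT : Type) (X : nat -> aT -> R) (J : set nat)
    : set (set aT) :=
  [set E | exists (n : nat) (B : nat -> set (measurableTypeR R)),
    [/\ forall i, measurable (B i), forall i, ~ J i -> B i = setT,
        forall i, (n <= i)%N -> B i = setT &
        E = \bigcap_i (X i @^-1` B i)]].

Lemma setI_closed_rectangle (R : realType) (aT : Type) (X : nat -> aT -> R) J :
  setI_closed (rectangle X J).
Proof.
move=> _ _ [n [B [mB BJ Bn ->]]] [p [C [mC CJ Cp ->]]].
exists (maxn n p), (fun i => B i `&` C i); split.
- by move=> i; exact: measurableI.
- by move=> i Ji; rewrite BJ// CJ// setTI.
- by move=> i; rewrite geq_max => /andP[ni pi]; rewrite Bn// Cp// setTI.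
- by rewrite -bigcapI.
Qed.

Lemma sigma_gen_rectangle (R : realType) (aT : Type) (X : nat -> aT -> R) J :
  sigma_gen X J = <<s rectangle X J >>.
Proof.
apply/seteqP; split.
  apply: sigma_gen_sub => [|j B Jj mB]; first exact: smallest_sigma_algebra.
  apply: sub_sigma_algebra; exists j.+1, (fun i => if i == j then B else setT).
  split.
  - by move=> i; case: ifP.
  - by move=> i Ji; case: eqP => // ij; rewrite ij in Ji.
  - by move=> i; case: eqP => // ->; rewrite ltnn.
  - apply/seteqP; split => [w Bw i _|w]; rewrite /preimage/=; first by case: eqP => // ->.
    by move=> /(_ j I); rewrite eqxx.
apply: smallest_sub; first exact: sigma_gen_sigma_algebra.
move=> _ [n [B [mB BJ _ ->]]].
apply: sigma_algebra_bigcap => [|i]; first exact: sigma_gen_sigma_algebra.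
have [Ji|Ji] := pselect (J i); first exact: sigma_gen_preimage.
by rewrite BJ// preimage_setT; apply: sigma_algebraT; exact: sigma_gen_sigma_algebra.
Qed.

Lemma sigma_gen_pi (R : realType) (aT : Type) (X : nat -> aT -> R) J (H : set (set aT)) :
  dynkin H -> rectangle X J `<=` H -> sigma_gen X J `<=` H.
Proof.
by move=> dH; rewrite sigma_gen_rectangle; apply: pi_dynkin_sub => //; exact: setI_closed_rectangle.
Qed.

(** * The transition operator of the walk *)

Section kprecomp.
Context d d' d'' (X : measurableType d) (Y : measurableType d')
  (Z : measurableType d'') (R : realType).
Context (k : R.-pker Y ~> Z) (f : X -> Y).

(** Serves to read a kernel at the second coordinate of a state, at [V n], or at a clamped value.
    The proof [mf] is an argument so that the kernel structure can be inferred from the term. *)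
Definition kprecomp (mf : measurable_fun setT f) (x : X) :
  {measure set Z -> \bar R} := k (f x).

Context (mf : measurable_fun setT f).

Let measurable_kprecomp U : measurable U ->
  measurable_fun setT (kprecomp mf ^~ U).
Proof. by move=> mU; exact: (measurableT_comp (measurable_kernel k U mU) mf). Qed.

HB.instance Definition _ := isKernel.Build _ _ _ _ _ (kprecomp mf)
  measurable_kprecomp.

Let kprecomp_prob x : kprecomp mf x setT = 1%E.
Proof. exact: prob_kernel. Qed.

HB.instance Definition _ := Kernel_isProbability.Build _ _ _ _ _
  (kprecomp mf) kprecomp_prob.

End kprecomp.

Section walk_step.
Local Open Scope ereal_scope.
Context (R : realType).
Local Notation mR := (measurableTypeR R).
Context (K : R.-pker mR ~> mR).
Implicit Types (f g : mR * mR -> \bar R) (z : mR * mR).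

Definition walk_step f z := \int[K z.2]_y f ((z.1 + y)%R, y).

Lemma measurable_walk_arg f z : measurable_fun setT f ->
  measurable_fun setT (fun y : mR => f ((z.1 + y)%R, y)).
Proof.
move=> mf; apply: measurableT_comp => //.
by apply/measurable_fun_pair => //=; exact: measurable_funD.
Qed.

Lemma walk_step_ge0 f z : (forall z, 0 <= f z) -> 0 <= walk_step f z.
Proof. by move=> f0; exact: integral_ge0. Qed.

Lemma measurable_walk_step f : (forall z, 0 <= f z) -> measurable_fun setT f ->
  measurable_fun setT (walk_step f).
Proof.
move=> f0 mf.
apply: (measurable_fun_integral_finite_kernel
  (fun zy : (mR * mR) * mR => f ((zy.1.1 + zy.2)%R, zy.2))
  (kprecomp K (@measurable_snd _ _ mR mR))) => //=.
apply: measurableT_comp => //; apply/measurable_fun_pair => //=.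
apply: measurable_funD => //; exact: measurableT_comp.
Qed.

Lemma walk_step_le f g z : (forall z, 0 <= f z) -> measurable_fun setT f ->
  measurable_fun setT g -> (forall z, f z <= g z) -> walk_step f z <= walk_step g z.
Proof.
move=> f0 mf mg fg; apply: ge0_le_integral => //; exact: measurable_walk_arg.
Qed.

Lemma walk_stepD f g z : (forall z, 0 <= f z) -> measurable_fun setT f ->
  (forall z, 0 <= g z) -> measurable_fun setT g ->
  walk_step (f \+ g) z = walk_step f z + walk_step g z.
Proof.
move=> f0 mf g0 mg; rewrite /walk_step ge0_integralD//; exact: measurable_walk_arg.
Qed.

Lemma walk_stepZ f z (a : \bar R) : (forall z, 0 <= f z) -> measurable_fun setT f ->
  0 <= a -> walk_step (fun z => a * f z) z = a * walk_step f z.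
Proof.
move=> f0 mf a0; rewrite /walk_step ge0_integralZl//; exact: measurable_walk_arg.
Qed.

Lemma walk_step_cst a z : walk_step (cst a) z = a.
Proof. by rewrite /walk_step integral_cst// prob_kernel mule1. Qed.

End walk_step.

(** * Lebesgue integrals of nonnegative functions under translation *)

Section nonneg_integrals.
Local Open Scope ereal_scope.

Lemma ge0_integral_mrestr d (T : measurableType d) (R : realType)
    (mu : {measure set T -> \bar R}) (D : set T) (mD : measurable D)
    (f : T -> \bar R) : measurable_fun setT f -> (forall x, 0 <= f x) ->
  \int[mrestr mu mD]_x f x = \int[mu]_(x in D) f x.
Proof.
move=> mf f0; rewrite -(setUv D) ge0_integral_setU//=; last 3 first.
- exact: measurableC.
- by rewrite setUv; exact: mf.
- by rewrite disj_set2E setICr.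
rewrite [X in _ + X](eq_measure_integral mzero) ?integral_measure_zero ?adde0; last first.
  by move=> A mA AD; rewrite /= /mrestr (disjoints_subset _ _).2 ?measure0.
by apply: eq_measure_integral => A mA AD; rewrite /= /mrestr setIidl.
Qed.

Lemma ge0_cst_le_integral d (T : measurableType d) (R : realType)
    (mu : {measure set T -> \bar R}) (D : set T) (mD : measurable D)
    (f : T -> \bar R) (a : \bar R) : measurable_fun D f -> 0 <= a ->
  (forall x, D x -> a <= f x) -> a * mu D <= \int[mu]_(x in D) f x.
Proof.
move=> mf a0 af; rewrite -integral_cst//; exact: ge0_le_integral.
Qed.

Context (R : realType).
Local Notation mR := (measurableTypeR R).
Local Notation leb := (@lebesgue_measure R).

(** The pushforward gives each half-open interval its length, which characterises Lebesgue
    measure. *)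
Lemma lebesgue_measure_translate (x : R) (A : set mR) : measurable A ->
  pushforward leb (fun y : mR => (x + y)%R : mR) A = leb A.
Proof.
move=> mA; apply/esym.
have mx : measurable_fun setT (fun y : mR => (x + y)%R : mR).
  exact: measurable_funD.
pose h : {mfun mR >-> mR} := HB.pack (fun y : mR => (x + y)%R : mR)
  (isMeasurableFun.Build _ _ _ _ _ mx).
apply: (@lebesgue_measure_unique _ (pushforward leb h)) => // _ [[a b]] _ <-.
transitivity (leb `](a - x)%R, (b - x)%R]%classic).
  rewrite !lebesgue_measure_itv/= !lte_fin ltrD2r; case: ifP => // _.
  by rewrite -!EFinD; congr EFin; ring.
congr (leb _); apply/seteqP.
by split => y; rewrite /= !in_itv/=; move=> /andP[? ?]; apply/andP; split; lra.
Qed.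

Lemma ge0_integral_translate (f : mR -> \bar R) (x : R) (D : set mR) : measurable D ->
  measurable_fun setT f -> (forall y, 0 <= f y) ->
  \int[leb]_(y in (fun y => (x + y)%R) @^-1` D) f (x + y)%R = \int[leb]_(y in D) f y.
Proof.
move=> mD mf f0.
have mx : measurable_fun setT (fun y : mR => (x + y)%R : mR).
  exact: measurable_funD.
rewrite -(ge0_integral_pushforward mx leb mD (measurable_funS measurableT (@subsetT _ D) mf))//.
by apply: eq_measure_integral => A mA AD; exact: lebesgue_measure_translate.
Qed.

Lemma ge0_integral_translate_itv (f : mR -> \bar R) (x p q : R) :
  measurable_fun setT f -> (forall y, 0 <= f y) ->
  \int[leb]_(y in `]p, q]) f (x + y)%R = \int[leb]_(y in `](x + p)%R, (x + q)%R]) f y.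
Proof.
move=> mf f0.
have -> : `]p, q]%classic = (fun y => (x + y)%R) @^-1` `](x + p)%R, (x + q)%R].
  apply/seteqP.
  by split => y; rewrite /= !in_itv/=; move=> /andP[? ?]; apply/andP; split; lra.
exact: ge0_integral_translate.
Qed.

Lemma ge0_integral_itv_cat (f : mR -> \bar R) (p m q : R) :
  measurable_fun setT f -> (forall y, 0 <= f y) -> (p <= m)%R -> (m <= q)%R ->
  \int[leb]_(y in `]p, q]) f y =
  \int[leb]_(y in `]p, m]) f y + \int[leb]_(y in `]m, q]) f y.
Proof.
move=> mf f0 pm mq.
rewrite (@itv_bndbnd_setU _ _ _ (BRight m)) ?bnd_simp//.
rewrite ge0_integral_setU//.
  exact: measurable_funS mf.
rewrite disj_set2E; apply/eqP/seteqP; split => // y [] /=.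
by rewrite !in_itv/= => /andP[_ +] /andP[+ _]; rewrite leNgt => /negbTE ->.
Qed.

(** Translation by a multiple of the period brings the window back to 0. Windows starting at a
    multiple of [t] are enough, since every window of length [2 * t] contains one of them. *)
Lemma ge0_integral_periodic (f : mR -> \bar R) (t : R) (k : int) :
  measurable_fun setT f -> (forall y, 0 <= f y) -> (forall y, f (y + t)%R = f y) ->
  \int[leb]_(y in `](t *~ k)%R, (t *~ k + t)%R]) f y = \int[leb]_(y in `]0%R, t]) f y.
Proof.
move=> mf f0 ft.
have ftk y : f (t *~ k + y)%R = f y.
  have ftn n z : f (z + t *+ n)%R = f z.
    by elim: n z => [|n IH] z; rewrite ?mulr0n ?addr0// mulrSr addrA ft.
  case: k => n; first by rewrite addrC -pmulrn ftn.
  by rewrite NegzE mulrNz -(ftn n.+1 (_ + y)%R) addrAC -pmulrn addNr add0r.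
rewrite -[X in `]X, _]](addr0 (t *~ k)) -ge0_integral_translate_itv//.
by apply: eq_integral => y _; rewrite ftk.
Qed.

End nonneg_integrals.

(** * Iterates of the transition operator *)

Section walk_iter.
Local Open Scope ereal_scope.
Context (R : realType).
Local Notation mR := (measurableTypeR R).
Context (K : R.-pker mR ~> mR).
Implicit Types (f g : mR * mR -> \bar R) (z : mR * mR).
Local Notation L n f := (iter n (walk_step K) f).

Lemma walk_iter_nneg n f : (forall z, 0 <= f z) -> measurable_fun setT f ->
  (forall z, 0 <= L n f z) /\ measurable_fun setT (L n f).
Proof.
move=> f0 mf; elim: n => [//|n [IH0 IHm]] /=; split => [z|].
  exact: walk_step_ge0.
exact: measurable_walk_step.
Qed.

Lemma walk_iter_le n f g : (forall z, 0 <= f z) -> measurable_fun setT f ->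
  measurable_fun setT g -> (forall z, f z <= g z) -> forall z, L n f z <= L n g z.
Proof.
move=> f0 mf mg fg; have g0 z : 0 <= g z by exact: le_trans (fg z).
elim: n => [//|n IH] z /=; apply: walk_step_le => //.
- by have [] := walk_iter_nneg n f0 mf.
- by have [] := walk_iter_nneg n f0 mf.
- by have [] := walk_iter_nneg n g0 mg.
Qed.

Lemma walk_iterD n f g : (forall z, 0 <= f z) -> measurable_fun setT f ->
  (forall z, 0 <= g z) -> measurable_fun setT g ->
  L n (f \+ g) = L n f \+ L n g.
Proof.
move=> f0 mf g0 mg; elim: n => [//|n IH] /=; apply/funext => z.
have [? ?] := walk_iter_nneg n f0 mf; have [? ?] := walk_iter_nneg n g0 mg.
by rewrite IH walk_stepD.
Qed.

Lemma walk_iterZ n f (a : \bar R) : (forall z, 0 <= f z) -> measurable_fun setT f ->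
  0 <= a -> L n (fun z => a * f z) = (fun z => a * L n f z).
Proof.
move=> f0 mf a0; elim: n => [//|n IH] /=; apply/funext => z.
have [? ?] := walk_iter_nneg n f0 mf.
by rewrite IH walk_stepZ.
Qed.

Lemma walk_iter_cst n (a : \bar R) : L n (cst a) = cst a.
Proof.
by elim: n => [//|n /= ->]; apply/funext => z; rewrite walk_step_cst.
Qed.

Lemma walk_iter_periodic n f (t : R) : (forall z, f ((z.1 + t)%R, z.2) = f z) ->
  forall z, L n f ((z.1 + t)%R, z.2) = L n f z.
Proof.
move=> ft; elim: n => [//|n IH] z /=; apply: eq_integral => y _ /=.
by rewrite addrAC (IH ((z.1 + y)%R, y)).
Qed.

End walk_iter.

(** * Spreading of mass by steps in an interval *)

Section minorization.
Local Open Scope ereal_scope.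
Context (R : realType).
Local Notation mR := (measurableTypeR R).
Local Notation leb := (@lebesgue_measure R).
Context (K : R.-pker mR ~> mR) (a b c : R).
Hypothesis (ab : (a < b)%R) (c0 : (0 < c)%R).
Local Notation J := (`]a, b[%classic : set mR).
Hypothesis KJ : forall v (A : set mR), J v -> measurable A -> A `<=` J ->
  c%:E * leb A <= K v A.
Local Notation L n f := (iter n (walk_step K) f).
Local Notation w := (b - a)%R.

(** [c] times Lebesgue measure restricted to [J] is itself a measure, dominated by [K v] on every
    set, and domination of measures passes to integrals. *)
Lemma le_integral_kernel (g : mR -> \bar R) (v : R) : J v -> measurable_fun setT g ->
  (forall y, 0 <= g y) -> c%:E * \int[leb]_(y in J) g y <= \int[K v]_y g y.
Proof.
move=> Jv mg g0.
have mJ : measurable J by exact: measurable_itv.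
have cnn : (0 <= c)%R by exact: ltW.
pose c' : {nonneg R} := NngNum cnn.
rewrite -(ge0_integral_mrestr _ mJ)//.
rewrite -[c]/(c'%:num)%R -ge0_integral_mscale//.
apply: ge0_le_measure_integral => // S mS.
rewrite /= /mscale/= /mrestr; apply: (@le_trans _ _ (K v (S `&` J))).
  by apply: KJ => //; exact: measurableI.
by apply: le_measure => //; rewrite inE//; exact: measurableI.
Qed.

(** A function of the position, killed unless the last step lies in [J]: the domination [KJ] is
    available only from such states, so the spreading steps have to end in [J] again. *)
Definition strip (f : mR -> \bar R) (z : mR * mR) := f z.1 * (\1_J z.2)%:E.

Lemma strip_ge0 f z : (forall x, 0 <= f x) -> 0 <= strip f z.
Proof. by move=> f0; rewrite mule_ge0// lee_fin. Qed.

Lemma measurable_strip f : measurable_fun setT f -> measurable_fun setT (strip f).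
Proof.
move=> mf; apply: emeasurable_funM; first exact: measurableT_comp.
by apply/measurable_EFinP; exact: measurableT_comp.
Qed.

(* The spreading step: moving by a uniform step of ]a, b[ widens the window by
   half of b - a, seen from the outer quarters of ]a, b[. *)
Lemma walk_iter_spread n : exists e p q : R,
  [/\ (0 < e)%R, (q - p = w + n%:R * (w / 2))%R &
    forall f, measurable_fun setT f -> (forall x, 0 <= f x) ->
    forall z, J z.2 ->
    e%:E * \int[leb]_(y in `](z.1 + p)%R, (z.1 + q)%R]) f y <= L n.+1 (strip f) z].
Proof.
have w0 : (0 < w)%R by rewrite subr_gt0.
elim: n => [|n [e [p [q [e0 pq IH]]]]].
  exists c, a, b; split => //; first by rewrite mul0r addr0.
  move=> f mf f0 z Jz /=.
  rewrite -ge0_integral_translate_itv//.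
  have mfz : measurable_fun setT (fun y : mR => f (z.1 + y)%R).
    by apply: measurableT_comp => //; exact: measurable_funD.
  rewrite -integral_itv_bndo_bndc; last exact: measurable_funS mfz.
  apply: (@le_trans _ _ (c%:E * \int[leb]_(y in J) strip f ((z.1 + y)%R, y))).
    rewrite lee_pmul2l//.
    rewrite le_eqVlt; apply/orP; left; apply/eqP.
    by apply: eq_integral => y yJ; rewrite /strip/= indicE yJ mule1.
  apply: le_integral_kernel => //.
  - exact: (measurable_walk_arg z (measurable_strip mf)).
  - by move=> y; exact: strip_ge0.
(* The first step lies in an outer quarter of []a, b[], of length [w / 4], with density at least
   [c]; the induction hypothesis contributes [e]. The new ends are the worst left end for a step in
   the left quarter and the worst right end for a step in the right quarter, so the window grows by
   [w / 2]. *)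
exists (c * (w / 4) * e)%R, (a + w / 4 + p)%R, (b - w / 4 + q)%R; split.
- by rewrite !mulr_gt0// divr_gt0.
- rewrite -[n.+1%:R]natr1 (_ : q = p + (w + n%:R * (w / 2)))%R; last by rewrite -pq; lra.
  by field.
move=> f mf f0 z Jz; rewrite iterS.
have [G0 mG] := walk_iter_nneg K n.+1 (fun z => strip_ge0 z f0) (measurable_strip mf).
set G := L n.+1 (strip f) in IH G0 mG *.
have pqw : (w <= q - p)%R by rewrite pq lerDl mulr_ge0// divr_ge0// ltW.
have mGz := measurable_walk_arg z mG.
apply: le_trans (le_integral_kernel Jz mGz _) => //.
pose Q1 : set mR := `]a, (a + w / 4)%R]%classic; pose Q2 : set mR := `](b - w / 4)%R, b[%classic.
have mQ1 : measurable Q1 by exact: measurable_itv.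
have mQ2 : measurable Q2 by exact: measurable_itv.
(* For every first step in [Q1] the shifted window contains the domain of [I1], and for every one in
   [Q2] that of [I2]; the latter uses [b + p <= a + q], which is [pqw]. *)
pose I1 := \int[leb]_(y in `](z.1 + (a + w / 4 + p))%R, (z.1 + (a + q))%R]) f y.
pose I2 := \int[leb]_(y in `](z.1 + (a + q))%R, (z.1 + (b - w / 4 + q))%R]) f y.
have I10 : 0 <= I1 by exact: integral_ge0.
have I20 : 0 <= I2 by exact: integral_ge0.
have -> : \int[leb]_(y in `](z.1 + (a + w / 4 + p))%R, (z.1 + (b - w / 4 + q))%R]) f y
    = I1 + I2.
  by rewrite (@ge0_integral_itv_cat _ _ _ (z.1 + (a + q))%R)//; lra.
have lebQ1 : leb Q1 = (w / 4)%:E.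
  by rewrite lebesgue_measure_itv/= lte_fin ifT -?EFinD; [congr EFin; ring|lra].
have lebQ2 : leb Q2 = (w / 4)%:E.
  by rewrite lebesgue_measure_itv/= lte_fin ifT -?EFinD; [congr EFin; ring|lra].
have sub_le p1 q1 p2 q2 : (p2 <= p1)%R -> (q1 <= q2)%R ->
    \int[leb]_(y in `]p1, q1]) f y <= \int[leb]_(y in `]p2, q2]) f y.
  move=> pp qq; apply: ge0_subset_integral => //; first exact: measurable_funS mf.
  by move=> y /=; rewrite !in_itv/= => /andP[? ?]; apply/andP; split; lra.
have H1 : e%:E * I1 * (w / 4)%:E <= \int[leb]_(y in Q1) G ((z.1 + y)%R, y).
  rewrite -lebQ1; apply: ge0_cst_le_integral => //.
  - exact: measurable_funS mGz.
  - by rewrite mule_ge0// lee_fin ltW.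
  move=> y; rewrite /Q1/= in_itv/= => /andP[ay yw].
  have Jy : J y by rewrite /= in_itv/= ay/=; lra.
  apply: le_trans (IH f mf f0 ((z.1 + y)%R, y) Jy) => /=.
  by rewrite lee_pmul2l//; apply: sub_le; lra.
have H2 : e%:E * I2 * (w / 4)%:E <= \int[leb]_(y in Q2) G ((z.1 + y)%R, y).
  rewrite -lebQ2; apply: ge0_cst_le_integral => //.
  - exact: measurable_funS mGz.
  - by rewrite mule_ge0// lee_fin ltW.
  move=> y; rewrite /Q2/= in_itv/= => /andP[ay yw].
  have Jy : J y by rewrite /= in_itv/= yw andbT; lra.
  apply: le_trans (IH f mf f0 ((z.1 + y)%R, y) Jy) => /=.
  by rewrite lee_pmul2l//; apply: sub_le; lra.
have -> : (c * (w / 4) * e)%:E * (I1 + I2) =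
    c%:E * (e%:E * I1 * (w / 4)%:E + e%:E * I2 * (w / 4)%:E).
  rewrite -ge0_muleDl ?mule_ge0 ?lee_fin//; [|exact: ltW..].
  rewrite -ge0_muleDr// !EFinM -!muleA; congr (_ * _).
  by rewrite muleA muleC -muleA.
rewrite lee_pmul2l//; apply: le_trans (leeD H1 H2) _.
rewrite -ge0_integral_setU//; last 2 first.
- exact: measurable_funS mGz.
- rewrite disj_set2E; apply/eqP/seteqP; split => // y [] /=.
  by rewrite /Q1 /Q2/= !in_itv/= => /andP[? ?] /andP[? ?]; lra.
apply: ge0_subset_integral => //; first exact: measurableU.
  exact: measurable_funS mGz.
by move=> y []; rewrite /Q1 /Q2/= !in_itv/= => /andP[? ?]; apply/andP; split; lra.
Qed.

End minorization.

(** * Doeblin minorization and contraction *)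

Section doeblin.
Local Open Scope ereal_scope.
Context (R : realType).
Local Notation mR := (measurableTypeR R).
Local Notation leb := (@lebesgue_measure R).
Context (K : R.-pker mR ~> mR) (a b c : R).
Hypothesis (ab : (a < b)%R) (c0 : (0 < c)%R).
Local Notation J := (`]a, b[%classic : set mR).
Hypothesis KJ : forall v (A : set mR), J v -> measurable A -> A `<=` J ->
  c%:E * leb A <= K v A.
Local Notation L n f := (iter n (walk_step K) f).
Context (M : nat) (d0 : R).
Hypothesis (d00 : (0 < d0)%R).
Hypothesis LMJ : forall z, d0%:E <= L M (fun z : mR * mR => (\1_J z.2)%:E) z.
Context (t : R).
Hypothesis (t0 : (0 < t)%R).

(** Up to the factor [c], a lower bound of [walk_step K g] from states with second coordinate in
    [J], which depends on the position alone. *)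
Definition strip_average (g : mR * mR -> \bar R) (x : mR) : \bar R :=
  \int[leb]_(y in J) g ((x + y)%R, y).

(** Up to a factor, integration against the Doeblin minorizing measure, the same for all starting
    states; its total mass is [(b - a) * t]. *)
Definition minorant (g : mR * mR -> \bar R) : \bar R :=
  \int[leb]_(x in `]0%R, t]) strip_average g x.

Lemma strip_average_ge0 g x : (forall z, 0 <= g z) -> 0 <= strip_average g x.
Proof. by move=> g0; exact: integral_ge0. Qed.

Lemma measurable_strip_average g : measurable_fun setT g -> (forall z, 0 <= g z) ->
  measurable_fun setT (strip_average g).
Proof.
move=> mg g0.
pose q (z : mR * mR) := g ((z.1 + z.2)%R, z.2) * (\1_J z.2)%:E.
have -> : strip_average g = fubini_F leb q.
  apply/funext => x; rewrite /fubini_F /strip_average [LHS]integral_mkcond.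
  apply: eq_integral => y _; rewrite /q/= patchE indicE.
  by case: ifPn => yJ; rewrite ?mule1// mule0.
apply: measurable_fun_fubini_tonelli_F => [|z]; last by rewrite mule_ge0// lee_fin.
apply: emeasurable_funM.
  apply: measurableT_comp => //; apply/measurable_fun_pair => //=.
  by apply: measurable_funD.
by apply/measurable_EFinP; exact: measurableT_comp.
Qed.

Lemma minorantD f g : measurable_fun setT f -> (forall z, 0 <= f z) ->
  measurable_fun setT g -> (forall z, 0 <= g z) ->
  minorant (f \+ g) = minorant f + minorant g.
Proof.
move=> mf f0 mg g0; rewrite /minorant -ge0_integralD//.
- apply: eq_integral => x _; rewrite /strip_average ge0_integralD//.
  + exact: measurable_funS (measurable_walk_arg (x, x) mf).
  + exact: measurable_funS (measurable_walk_arg (x, x) mg).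
- by move=> x _; exact: strip_average_ge0.
- exact: measurable_funS (measurable_strip_average mf f0).
- by move=> x _; exact: strip_average_ge0.
- exact: measurable_funS (measurable_strip_average mg g0).
Qed.

Lemma minorant_cst (s : R) : minorant (cst s%:E) = (s * ((b - a) * t))%:E.
Proof.
have lJ : leb J = (b - a)%:E by rewrite lebesgue_measure_itv/= lte_fin ab.
have lt : leb `]0%R, t] = t%:E by rewrite lebesgue_measure_itv/= lte_fin t0 oppr0 adde0.
rewrite /minorant [X in integral _ _ X](_ : _ = cst (s * (b - a))%:E); last first.
  by apply/funext => x; rewrite /strip_average integral_cst//= lJ EFinM.
by rewrite integral_cst//= lt -EFinM mulrA.
Qed.

(** In the order of time: [M] steps reach [J], then [n + 2] spreading steps give the position a
    density bounded below on a window of length at least [2 * t], and one last step does the same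
    for the pair of position and step. A periodic function then sees a full period. *)
Lemma minorization : exists (N : nat) (e : R), [/\ (0 < N)%N, (0 < e)%R &
  forall g, measurable_fun setT g -> (forall z, 0 <= g z) ->
    (forall z, g ((z.1 + t)%R, z.2) = g z) ->
    forall z, e%:E * minorant g <= L N g z].
Proof.
have w0 : (0 < b - a)%R by rewrite subr_gt0.
(* This makes [n.+1] times [(b - a) / 2] exceed [2 * t], so that the window contains a full period
   starting at a multiple of [t], wherever it begins. *)
pose n := Num.truncn (4 * t / (b - a)).
have [e [p [q [e0 pq H]]]] := walk_iter_spread ab c0 KJ n.+1.
have pqt : (2 * t <= q - p)%R.
  rewrite pq.
  have : (4 * t / (b - a) < n.+1%:R)%R by exact: truncnS_gt.
  rewrite ltr_pdivrMr// => h; nra.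
exists (M + n.+3)%N, (c * e * d0)%R; split.
- by rewrite addnS.
- by rewrite !mulr_gt0.
move=> g mg g0 gt z.
pose F := strip_average g.
have mF : measurable_fun setT F by exact: measurable_strip_average.
have F0 x : 0 <= F x by exact: strip_average_ge0.
have Ft x : F (x + t)%R = F x.
  by apply: eq_integral => y _; rewrite addrAC (gt ((x + y)%R, y)).
have mn0 : 0 <= minorant g by exact: integral_ge0.
have mS := measurable_strip a b mF; have S0 y := strip_ge0 a b y F0.
have mI : measurable_fun setT (fun z : mR * mR => (\1_J z.2)%:E : \bar R).
  by apply/measurable_EFinP; exact: measurableT_comp.
have I0 (u : mR * mR) : 0 <= (\1_J u.2)%:E :> \bar R by rewrite lee_fin.
have step1 z' : c%:E * strip a b F z' <= L 1 g z'.
  rewrite /strip indicE; case: (boolP (z'.2 \in J)) => zJ; last first.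
    by rewrite !mule0 walk_step_ge0.
  rewrite mule1; apply: (le_integral_kernel c0 KJ) => //; first exact: set_mem.
  exact: (measurable_walk_arg z' mg).
have step2 z' : e%:E * minorant g * (\1_J z'.2)%:E <= L n.+2 (strip a b F) z'.
  rewrite indicE; case: (boolP (z'.2 \in J)) => zJ; last first.
    by rewrite mule0; have [] := walk_iter_nneg K n.+2 S0 mS.
  rewrite mule1; apply: le_trans (H F mF F0 z' (set_mem zJ)).
  rewrite lee_pmul2l//.
  (* [t *~ k] is the first multiple of [t] at or beyond the left end of the window. *)
  pose k := Num.ceil ((z'.1 + p) / t).
  have k1 : (z'.1 + p <= t *~ k)%R.
    by rewrite -mulrzl -ler_pdivrMr//; exact: ceil_ge.
  have k2 : (t *~ k < z'.1 + p + t)%R.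
    have : (k%:~R - 1 < (z'.1 + p) / t)%R by have := ceilB1_lt ((z'.1 + p) / t); rewrite intrB.
    by rewrite ltr_pdivlMr// -[(t *~ k)%R]mulrzl mulrBl mul1r ltrBlDr.
  rewrite /minorant -(ge0_integral_periodic k mF F0 Ft).
  apply: ge0_subset_integral => //; first exact: measurable_funS mF.
  by move=> y; rewrite /= !in_itv/= => /andP[? ?]; apply/andP; split; lra.
have [L10 mL1] := walk_iter_nneg K 1 g0 mg.
have cF0 z' : 0 <= c%:E * strip a b F z' by rewrite mule_ge0// lee_fin ltW.
have mcF : measurable_fun setT (fun z' => c%:E * strip a b F z') by exact: measurable_funeM.
rewrite iterD (iterSr n.+2).
apply: (@le_trans _ _ (L M (L n.+2 (fun z' => c%:E * strip a b F z')) z)); last first.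
  have [cL0 mcL] := walk_iter_nneg K n.+2 cF0 mcF.
  have [_ mLL] := walk_iter_nneg K n.+2 L10 mL1.
  exact: (walk_iter_le K M cL0 mcL mLL (walk_iter_le K n.+2 cF0 mcF mL1 step1)).
have [Sn0 mSn] := walk_iter_nneg K n.+2 S0 mS.
rewrite walk_iterZ// ?lee_fin ?(ltW c0)//.
rewrite walk_iterZ// ?lee_fin ?(ltW c0)//.
have em0 : 0 <= e%:E * minorant g by rewrite mule_ge0// lee_fin ltW.
apply: (@le_trans _ _ (c%:E * L M (fun z' => e%:E * minorant g * (\1_J z'.2)%:E) z)).
  rewrite walk_iterZ// !EFinM -!muleA lee_pmul2l// lee_pmul2l//.
  by rewrite muleC lee_wpmul2l.
rewrite lee_pmul2l//; apply: walk_iter_le => //.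
  by move=> z'; rewrite mule_ge0.
exact: measurable_funeM.
Qed.

End doeblin.

(** * Geometric contraction of oscillations *)

Lemma bernoulli_le (R : realType) (x : R) n : 0 <= x <= 1 -> 1 - n%:R * x <= (1 - x) ^+ n.
Proof.
move=> /andP[x0 x1]; elim: n => [|n IH]; first by rewrite mul0r subr0.
rewrite exprS; apply: le_trans (ler_wpM2l _ IH); last by rewrite subr_ge0.
rewrite -natr1; have : 0 <= n%:R * (x * x) by rewrite !mulr_ge0.
by rewrite mulrA; lra.
Qed.

Section contraction.
Local Open Scope ereal_scope.
Context (R : realType).
Local Notation mR := (measurableTypeR R).
Local Notation leb := (@lebesgue_measure R).
Context (K : R.-pker mR ~> mR) (a b c : R).
Hypothesis (ab : (a < b)%R) (c0 : (0 < c)%R).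
Local Notation J := (`]a, b[%classic : set mR).
Hypothesis KJ : forall v (A : set mR), J v -> measurable A -> A `<=` J ->
  c%:E * leb A <= K v A.
Local Notation L n f := (iter n (walk_step K) f).
Context (M : nat) (d0 : R).
Hypothesis (d00 : (0 < d0)%R).
Hypothesis LMJ : forall z, d0%:E <= L M (fun z : mR * mR => (\1_J z.2)%:E) z.
Context (t : R).
Hypothesis (t0 : (0 < t)%R).

Lemma walk_iter_between n (f : mR * mR -> \bar R) (l u : R) : (0 <= l)%R ->
  measurable_fun setT f -> (forall z, l%:E <= f z <= u%:E) ->
  forall z, l%:E <= L n f z <= u%:E.
Proof.
move=> l0 mf flu z.
have f0 z' : 0 <= f z'.
  by have /andP[+ _] := flu z'; apply: le_trans; rewrite lee_fin.
have E r : r%:E = L n (cst r%:E) z by rewrite walk_iter_cst.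
apply/andP; split; [rewrite (E l)|rewrite (E u)].
  by apply: walk_iter_le => // z'; have /andP[] := flu z'.
by apply: walk_iter_le => // z'; have /andP[] := flu z'.
Qed.

(** Both [f - l] and [u - f] are nonnegative, and their minorants add up to [u - l] times a
    constant. Minorizing the first raises the lower bound, minorizing the second lowers the upper
    one, and together the gap loses a fixed proportion. *)
Lemma walk_contraction : exists (N : nat) (e : R), [/\ (0 < N)%N, (0 < e < 1)%R &
  forall (f : mR * mR -> \bar R) (l u : R), (0 <= l)%R ->
    measurable_fun setT f -> (forall z, f ((z.1 + t)%R, z.2) = f z) ->
    (forall z, l%:E <= f z <= u%:E) ->
  exists l' u' : R, [/\ (0 <= l')%R, (u' - l' = (1 - e) * (u - l))%R &
    forall z, l'%:E <= L N f z <= u'%:E]].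
Proof.
have [N [e [N0 e0 H]]] := minorization ab c0 KJ d00 LMJ t0.
pose W : R := ((b - a) * t)%R.
have W0 : (0 < W)%R by rewrite mulr_gt0// subr_gt0.
(* Minorization applied to the constant 1, which the iterates preserve. *)
have eW : (e * W <= 1)%R.
  have := H (cst 1%:E) (measurable_cst _) (fun _ => lee01) (fun=> erefl) (0%R, 0%R).
  by rewrite minorant_cst// walk_iter_cst mul1r -EFinM lee_fin.
have eW0 : (0 < e * W)%R by rewrite mulr_gt0.
(* As [e * W] might equal 1, halving it keeps the contraction factor positive. *)
exists N, (e * W / 2)%R; split => //.
  by apply/andP; split; [rewrite divr_gt0|rewrite ltr_pdivrMr// mul1r (le_lt_trans eW)// ltr1n].
move=> f l u l0 mf ft flu.
have ffin z : f z \is a fin_num.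
  have /andP[h1 h2] := flu z.
  by rewrite fin_numE gt_eqF ?lt_eqF// ?(le_lt_trans h2) ?ltry// (lt_le_trans _ h1)// ltNyr.
have lu : (l <= u)%R.
  by have /andP[h1 h2] := flu (0%R, 0%R); rewrite -lee_fin; exact: le_trans h2.
pose g1 z := f z - l%:E; pose g2 z := u%:E - f z.
have mg1 : measurable_fun setT g1 by exact: emeasurable_funB.
have mg2 : measurable_fun setT g2 by exact: emeasurable_funB.
have g10 z : 0 <= g1 z by rewrite sube_ge0 ?ffin//; have /andP[] := flu z.
have g20 z : 0 <= g2 z by rewrite sube_ge0 ?ffin//; have /andP[] := flu z.
have g1t z : g1 ((z.1 + t)%R, z.2) = g1 z by rewrite /g1 ft.
have g2t z : g2 ((z.1 + t)%R, z.2) = g2 z by rewrite /g2 ft.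
have l0' z : 0 <= cst l%:E z by rewrite lee_fin.
have f0 z : 0 <= f z by have /andP[+ _] := flu z; apply: le_trans.
have mc r : measurable_fun setT (cst r : mR * mR -> \bar R) by exact: measurable_cst.
(* Additivity of the iterates is available for nonnegative functions, so the differences are first
   rewritten as sums. *)
have E1 : f = g1 \+ cst l%:E by apply/funext => z; exact/esym/subeK.
have E2 : cst u%:E = g2 \+ f by apply/funext => z; exact/esym/subeK.
have E3 : cst (u - l)%:E = g1 \+ g2.
  apply/funext => z; rewrite /g1 /g2/= -(fineK (ffin z)) -!EFinB -EFinD.
  by congr EFin; ring.
have Lf : L N f = L N g1 \+ cst l%:E.
  by rewrite [in LHS]E1 walk_iterD// walk_iter_cst.
have Lu z : u%:E = L N g2 z + L N f z.
  have : L N (cst u%:E) z = (L N g2 \+ L N f) z by rewrite E2 walk_iterD.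
  by rewrite walk_iter_cst.
have mn10 : 0 <= minorant a b t g1 by apply: integral_ge0 => x _; exact: strip_average_ge0.
have mn20 : 0 <= minorant a b t g2 by apply: integral_ge0 => x _; exact: strip_average_ge0.
have mnD : minorant a b t g1 + minorant a b t g2 = ((u - l) * W)%:E.
  by rewrite -minorantD// -E3 minorant_cst.
have H1 z := H g1 mg1 g10 g1t z; have H2 z := H g2 mg2 g20 g2t z.
move: (minorant a b t g1) (minorant a b t g2) mn10 mn20 mnD H1 H2
  => v1 v2 v10 v20 vD H1 H2.
have le_fin v : 0 <= v -> v <= ((u - l) * W)%:E -> exists2 m, v = m%:E & (0 <= m)%R.
  move=> v0 vb; have vfin : v \is a fin_num by rewrite ge0_fin_numE// (le_lt_trans vb)// ltry.
  by exists (fine v); [rewrite fineK|exact: fine_ge0].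
have [m1 v1E m10] : exists2 m, v1 = m%:E & (0 <= m)%R by apply: le_fin; rewrite // -vD leeDl.
have [m2 v2E m20] : exists2 m, v2 = m%:E & (0 <= m)%R by apply: le_fin; rewrite // -vD leeDr.
have m12 : (m1 + m2 = (u - l) * W)%R by apply: EFin_inj; rewrite -vD v1E v2E.
exists (l + e / 2 * m1)%R, (u - e / 2 * m2)%R; split.
- by rewrite addr_ge0// mulr_ge0// divr_ge0// ltW.
- have -> : (u - e / 2 * m2 - (l + e / 2 * m1) = u - l - e / 2 * (m1 + m2))%R by ring.
  by rewrite m12; field.
move=> z.
have e2 m : (0 <= m)%R -> ((e / 2 * m)%:E <= e%:E * m%:E).
  by move=> m0; rewrite -EFinM lee_fin ler_wpM2r//; lra.
apply/andP; split.
  rewrite Lf/= EFinD addeC; apply: leeD2r; apply: le_trans (H1 z).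
  by rewrite v1E; exact: e2.
rewrite EFinB leeBrDl// (Lu z); apply: leeD2r; apply: le_trans (H2 z).
by rewrite v2E; exact: e2.
Qed.

(** Among [k] steps, [k %/ N] blocks of length [N] contract by [1 - e] each, and the remaining steps
    preserve the bounds. *)
Lemma walk_iter_oscillation : exists C r : R, [/\ (0 <= C)%R, (0 < r < 1)%R &
  forall (f : mR * mR -> \bar R) (k : nat),
    measurable_fun setT f -> (forall z, f ((z.1 + t)%R, z.2) = f z) ->
    (forall z, 0 <= f z <= 1) ->
  exists l u : R, [/\ (0 <= l)%R, (u - l <= C * r ^+ k)%R &
    forall z, l%:E <= L k f z <= u%:E]].
Proof.
have [N [e [N0 /andP[e0 e1] H]]] := walk_contraction.
have N1 : (1 <= N%:R :> R)%R by rewrite ler1n.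
have NR0 : (0 < N%:R :> R)%R by rewrite ltr0n.
(* A rate per single step: Bernoulli's inequality gives [1 - e <= r ^+ N]. *)
pose r : R := (1 - e / N%:R)%R.
have eN : (0 < e / N%:R)%R by rewrite divr_gt0.
have eN1 : (e / N%:R < 1)%R by rewrite ltr_pdivrMr// mul1r; lra.
have r0 : (0 < r)%R by rewrite subr_gt0.
have r1 : (r < 1)%R by rewrite /r; lra.
have erN : (1 - e <= r ^+ N)%R.
  apply: le_trans (bernoulli_le N _); last by rewrite !ltW.
  by rewrite mulrC divfK// lt0r_neq0.
(* The constant pays for the fewer than [N] steps left over. *)
exists (r ^- N)%R, r; split; rewrite ?r0 ?r1//.
  by rewrite invr_ge0 exprn_ge0// ltW.
move=> f k mf ft f01.
have f0 z : 0 <= f z by have /andP[] := f01 z.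
have mLn n : measurable_fun setT (L n f) by have [] := walk_iter_nneg K n f0 mf.
have [l [u [l0 lu Lb]]] : exists l u : R, [/\ (0 <= l)%R,
    (u - l <= (1 - e) ^+ (k %/ N))%R &
    forall z, l%:E <= L (N * (k %/ N)) f z <= u%:E].
  elim: (k %/ N)%N => [|q [l [u [l0 lu Lb]]]].
    by exists 0%R, 1%R; rewrite expr0 subr0 muln0.
  have [|l' [u' [l'0 lu' Lb']]] := H (L (N * q) f) l u l0 (mLn _) _ Lb.
    exact: walk_iter_periodic.
  exists l', u'; split => //.
    by rewrite lu' exprS ler_wpM2l// subr_ge0 ltW.
  by move=> z; rewrite mulnS iterD; exact: Lb'.
exists l, u; split => //; last first.
  by move=> z; rewrite (divn_eq k N) addnC mulnC iterD; exact: walk_iter_between.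
apply: (le_trans lu).
apply: (@le_trans _ _ (r ^+ (N * (k %/ N)))%R).
  by rewrite exprM lerXn2r// ?nnegrE ?exprn_ge0 ?subr_ge0 ?ltW.
have -> : (r ^+ k = r ^+ (N * (k %/ N)) * r ^+ (k %% N))%R.
  by rewrite -exprD mulnC -divn_eq.
rewrite mulrCA ler_peMr ?exprn_ge0 ?(ltW r0)// mulrC ler_pdivlMr ?exprn_gt0// mul1r.
by rewrite ler_wiXn2l ?(ltW r0) ?(ltW r1)// ltnW// ltn_mod.
Qed.

End contraction.

(** * Conditional expectations along the walk *)

Section krestr.
Context d (T : measurableType d) (R : realType) (P : probability T R)
  (E : set T) (mE : measurable E).

(** The dummy parameter turns the restricted measure into a finite kernel, which [kcomp] can compose
    with another kernel. *)
Definition krestr (_ : unit) : {measure set T -> \bar R} := mrestr P mE.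

Let measurable_krestr U : measurable U -> measurable_fun setT (krestr ^~ U).
Proof. by move=> mU; exact: measurable_cst. Qed.

HB.instance Definition _ := isKernel.Build _ _ _ _ _ krestr measurable_krestr.

Let krestr_uub : measure_fam_uub krestr.
Proof.
exists 2 => x; rewrite /krestr /= /mrestr; apply: (@le_lt_trans _ _ 1%E).
  by apply: probability_le1; exact: measurableI.
by rewrite lte_fin ltr1n.
Qed.

HB.instance Definition _ := Kernel_isFinite.Build _ _ _ _ _ krestr krestr_uub.

End krestr.

Section kgraph.
Context d d1 d2 (T : measurableType d) (S1 : measurableType d1)
  (S2 : measurableType d2) (R : realType).
Context (k : R.-pker T ~> S2) (X : T -> S1).

(** If [k w] is the conditional law of some [Y], this is the conditional law of the pair
    [(X, Y)]. *)
Definition kgraph (mX : measurable_fun setT X) (w : T) :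
  {measure set (S1 * S2) -> \bar R}.
Proof.
refine (pushforward (k w) (fun y => (X w, y))).
exact: measurable_fun_pair.
Defined.

Context (mX : measurable_fun setT X).

Let measurable_kgraph U : measurable U -> measurable_fun setT (kgraph mX ^~ U).
Proof.
move=> mU; rewrite (_ : kgraph mX ^~ U = fun w =>
  k w (xsection ((fun wy : T * S2 => (X wy.1, wy.2)) @^-1` U) w)); last first.
  apply/funext => w; rewrite /kgraph/= /pushforward; congr (k w _).
  by apply/seteqP; split => y; rewrite /xsection/= inE.
apply: measurable_fun_xsection_finite_kernel; rewrite inE.
rewrite -[X in measurable X]setTI.
have : measurable_fun setT (fun wy : T * S2 => (X wy.1, wy.2)).
  by apply/measurable_fun_pair => //=; exact: measurableT_comp.
exact.
Qed.

HB.instance Definition _ := isKernel.Build _ _ _ _ _ (kgraph mX) measurable_kgraph.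

Let kgraph_prob w : kgraph mX w setT = 1%E.
Proof. by rewrite /kgraph/= /pushforward preimage_setT prob_kernel. Qed.

HB.instance Definition _ := Kernel_isProbability.Build _ _ _ _ _ (kgraph mX) kgraph_prob.

End kgraph.

Section disintegration.
Local Open Scope ereal_scope.
Context d d1 d2 (T : measurableType d) (S1 : measurableType d1)
  (S2 : measurableType d2) (R : realType).
Context (P : probability T R) (E : set T) (mE : measurable E)
  (k : R.-pker T ~> S2) (X : T -> S1) (Y : T -> S2)
  (mX : measurable_fun setT X) (mY : measurable_fun setT Y).

Lemma measurable_prod_setX : @measurable _ (S1 * S2)%type =
  <<s [set C | exists A B, [/\ measurable A, measurable B & C = A `*` B]] >>.
Proof.
rewrite measurable_prod_measurableType; congr (<<s _ >>).
rewrite predeqE => C; split=> [[A mA [B mB <-]]|[A [B [mA mB ->]]]].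
  by exists A, B.
by exists A => //; exists B.
Qed.

(** Both sides integrate [g] against finite measures on the product: the law of [(X, Y)] under [P]
    restricted to [E], and this restriction composed with the graph kernel. By hypothesis they agree
    on rectangles, a generating pi-system. *)
Lemma conditional_integral :
  (forall A B, measurable A -> measurable B ->
    P (E `&` (X @^-1` A `&` Y @^-1` B)) = \int[P]_(w in E `&` X @^-1` A) k w B) ->
  forall g : S1 * S2 -> \bar R, measurable_fun setT g -> (forall z, 0 <= g z) ->
  \int[P]_(w in E) g (X w, Y w) = \int[P]_(w in E) \int[k w]_y g (X w, y).
Proof.
move=> H g mg g0.
have mXY : measurable_fun setT (fun w => (X w, Y w)) by apply/measurable_fun_pair.
pose l : R.-fker unit ~> T := krestr P mE.
pose q : R.-pker (unit * T)%type ~> (S1 * S2)%type :=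
  kprecomp (kgraph k mX) (@measurable_snd _ _ unit T).
have qg w : \int[q (tt, w)]_z g z = \int[k w]_y g (X w, y).
  rewrite ge0_integral_pushforward ?preimage_setT//; exact: measurable_fun_pair.
have mqg : measurable_fun setT (fun w => \int[k w]_y g (X w, y)).
  under eq_fun do rewrite -qg.
  by apply: measurable_fun_integral_kernel => // U mU; exact: (measurable_kernel (kgraph k mX)).
rewrite -(ge0_integral_mrestr _ mE)//; last exact: measurableT_comp mg mXY.
rewrite -(ge0_integral_mrestr _ mE)//; last by move=> w; exact: integral_ge0.
have mE1 A : measurable A -> measurable (E `&` X @^-1` A).
  by move=> mA; apply: measurableI => //; rewrite -[X in measurable X]setTI; exact: mX.
transitivity (\int[kcomp l q tt]_z g z); last first.
  by rewrite integral_kcomp//; apply: eq_integral => w _; rewrite qg.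
transitivity (\int[pushforward (mrestr P mE) (fun w => (X w, Y w))]_z g z).
  by rewrite ge0_integral_pushforward ?preimage_setT.
apply: eq_measure_integral => U mU _.
apply: (measure_unique _ (fun=> setT) measurable_prod_setX) => //.
- move=> _ _ [A [B [mA mB ->]]] [A' [B' [mA' mB' ->]]].
  by exists (A `&` A'), (B `&` B'); split; [exact: measurableI..|rewrite setXI].
- by move=> _; exists setT, setT; rewrite setXTT.
- by rewrite bigcup_const.
- move=> _ [A [B [mA mB ->]]].
  transitivity (\int[P]_(w in E `&` X @^-1` A) k w B).
    by rewrite -H// [E `&` _]setIC.
  apply/esym; rewrite [LHS](ge0_integral_mrestr _ mE)//; last first.
    exact: (measurable_kernel (kgraph k mX) _ (measurableX mA mB)).
  rewrite [RHS]integral_mkcondr; apply: eq_integral => w _.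
  rewrite patchE /q/= /kprecomp/= /kgraph/= /pushforward.
  case: ifPn => wA.
    congr (k w _); apply/seteqP; split => y /=; first by case.
    by move=> By; split => //; exact: set_mem wA.
  rewrite [X in k w X](_ : _ = set0) ?measure0//.
  by apply/seteqP; split => y // [/= Xw _]; move: wA; rewrite notin_setE; apply.
- move=> _; apply: (@le_lt_trans _ _ 1); last by rewrite ltry.
  by apply: probability_le1; apply: measurableI => //; rewrite preimage_setT.
Qed.

End disintegration.

(** Entry 0 is the initial position and entry [n.+1] is [V n], so that the entries up to [m]
    generate the past of the walk up to time [m]. *)
Definition walk_inputs (R : realType) (T : Type) (X V : nat -> T -> R) (n : nat) : T -> R :=
  if n is n'.+1 then V n' else X 0%N.

(** The functions of the state that serve as conditional probabilities of future events, when only a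
    periodic function of the position is observed. *)
Definition unit_periodic (R : realType) (t : R)
    (f : measurableTypeR R * measurableTypeR R -> \bar R) : Prop :=
  [/\ measurable_fun setT f, (forall z, 0 <= f z <= 1)%E &
      forall z, f (z.1 + t, z.2) = f z].

(** * Markov property and mixing of the walk *)

Section markov_walk.
Local Open Scope ereal_scope.
Context (R : realType).
Local Notation mR := (measurableTypeR R).
Context d (T : measurableType d) (P : probability T R) (X V : nat -> T -> mR).
Context (K : R.-pker mR ~> mR).
Hypothesis mX : forall n, measurable_fun setT (X n).
Hypothesis mV : forall n, measurable_fun setT (V n).
Hypothesis XS : forall n w, X n.+1 w = (X n w + V n w)%R.
Local Notation F m := (sigma_gen (walk_inputs X V) `I_m.+1).
Hypothesis markov : forall n E (A : set mR), F n.+1 E -> measurable A ->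
  P (E `&` V n.+1 @^-1` A) = \int[P]_(w in E) K (V n w) A.

Lemma measurable_preimage (Y : T -> mR) (B : set mR) :
  measurable_fun setT Y -> measurable B -> measurable (Y @^-1` B).
Proof. by move=> mY mB; rewrite -[X in measurable X]setTI; exact: mY. Qed.

Lemma walk_past_measurable m E : F m E -> measurable E.
Proof. by apply: sigma_gen_measurable => -[|j] _; [exact: mX|exact: mV]. Qed.

Lemma walk_past_mono m n : (m <= n)%N -> F m `<=` F n.
Proof. by move=> mn; apply: sigma_gen_mono => i /=; rewrite !ltnS => /leq_trans; exact. Qed.

Lemma walk_adapted m n (B : set mR) : (n <= m)%N -> measurable B -> F m (X n @^-1` B).
Proof.
move=> nm mB.
pose G : set (set T) := \bigcup_(j in `I_m.+1)
  preimage_set_system setT (walk_inputs X V j) (@measurable _ mR).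
suff h : measurable_fun setT (X n : g_sigma_algebraType G -> mR).
  by have := h measurableT B mB; rewrite setTI.
have base j : (j <= m)%N -> measurable_fun setT (walk_inputs X V j : g_sigma_algebraType G -> mR).
  move=> jm _ C mC; rewrite setTI; exact: (@sigma_gen_preimage _ _ _ (walk_inputs X V) `I_m.+1).
elim: n nm => [|n IH] nm; first exact: (base 0%N).
rewrite (_ : X n.+1 = (X n \+ V n)%R); last by apply/funext => w; rewrite XS.
apply: measurable_funD; first by apply: IH; exact: ltnW.
exact: (base n.+1).
Qed.

Lemma walk_state_adapted n (D : set (mR * mR)) : measurable D ->
  F n.+1 [set w | D (X n.+1 w, V n w)].
Proof.
move=> mD.
pose G : set (set T) := \bigcup_(j in `I_n.+2)
  preimage_set_system setT (walk_inputs X V j) (@measurable _ mR).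
suff h : measurable_fun setT (fun w : g_sigma_algebraType G => (X n.+1 w, V n w)).
  by have := h measurableT D mD; rewrite setTI.
apply/measurable_fun_pair => _ C mC; rewrite setTI; first exact: walk_adapted.
by apply: (@sigma_gen_preimage _ _ _ (walk_inputs X V) `I_n.+2 n.+1 C) => /=.
Qed.

Lemma markov_step n E (g : mR * mR -> \bar R) : F n.+1 E ->
  measurable_fun setT g -> (forall z, 0 <= g z) ->
  \int[P]_(w in E) g (X n.+2 w, V n.+1 w) =
  \int[P]_(w in E) walk_step K g (X n.+1 w, V n w).
Proof.
move=> FE mg g0.
(* As [X n.+2] is [X n.+1 + V n.+1], the integrand is a function of [X n.+1], known from the past,
   and of [V n.+1], drawn from [K]. *)
pose g' (z : mR * mR) := g ((z.1 + z.2)%R, z.2).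
have mg' : measurable_fun setT g'.
  by apply: measurableT_comp => //; apply/measurable_fun_pair => //=; exact: measurable_funD.
under eq_integral do rewrite XS.
apply: (fun H => @conditional_integral _ _ _ _ _ _ _ P E (walk_past_measurable FE)
  (kprecomp K (mV n)) (X n.+1) (V n.+1) (mX _) (mV _) H g' mg' (fun z => g0 _)) => A B mA mB.
rewrite setIA markov//.
exact: (sigma_gen_setI FE (walk_adapted (leqnn _) mA)).
Qed.

Lemma markov_iter k n E (g : mR * mR -> \bar R) : F n.+1 E ->
  measurable_fun setT g -> (forall z, 0 <= g z) ->
  \int[P]_(w in E) g (X (n + k).+1 w, V (n + k)%N w) =
  \int[P]_(w in E) iter k (walk_step K) g (X n.+1 w, V n w).
Proof.
move=> FE; elim: k g => [|k IH] g mg g0; first by rewrite addn0.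
rewrite iterSr -IH; last 2 first.
- exact: measurable_walk_step.
- by move=> z; exact: walk_step_ge0.
rewrite addnS markov_step//; apply: walk_past_mono FE.
by rewrite ltnS leq_addr.
Qed.

Context (phi : mR -> mR) (t : R).
Hypothesis mphi : measurable_fun setT phi.
Hypothesis phit : forall x, phi (x + t)%R = phi x.
Local Notation Phi := (fun n w => phi (X n w)).

(** Induction on the number [p] of constrained times. The function [f] does not depend on [n]
    because the walk is homogeneous in time. *)
Lemma future_rectangle p (B : nat -> set mR) : (forall i, measurable (B i)) ->
  (forall i, (p <= i)%N -> B i = setT) ->
  exists2 f, unit_periodic t f & forall n E, F n.+1 E ->
    P (E `&` \bigcap_i (Phi (n.+1 + i)%N @^-1` B i)) =
    \int[P]_(w in E) f (X n.+1 w, V n w).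
Proof.
elim: p B => [|p IH] B mB Bp.
  exists (cst 1); first by split => // z; rewrite /= lexx lee01.
  move=> n E FE; rewrite integral_cst ?mul1e; last exact: walk_past_measurable FE.
  rewrite (_ : \bigcap_i _ = setT) ?setIT//.
  by apply/seteqP; split => // w _ i _; rewrite /= Bp.
have [//||f [mf f01 ft] Hf] := IH (fun i => B i.+1); first by move=> i pi; rewrite Bp.
have f0 z : 0 <= f z by have /andP[] := f01 z.
have mBphi : measurable (phi @^-1` B 0%N).
  by rewrite -[X in measurable X]setTI; exact: mphi.
(* The first constraint is a condition on the current position; the others have conditional
   probability [f] one time later, pulled back by one step. *)
pose f' (z : mR * mR) := (\1_(phi @^-1` B 0%N) z.1)%:E * walk_step K f z.
have Lf0 z : 0 <= walk_step K f z by exact: walk_step_ge0.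
have mLf : measurable_fun setT (walk_step K f) by exact: measurable_walk_step.
exists f'.
  split.
  - apply: emeasurable_funM => //; apply/measurable_EFinP.
    apply: (measurableT_comp (measurable_indic _)) => //.
  - move=> z; rewrite /f' mule_ge0 ?lee_fin//=.
    apply: (@le_trans _ _ (walk_step K f z)).
      by rewrite -[leRHS]mul1e lee_wpmul2r// lee_fin indicE; case: (_ \in _).
    rewrite -[leRHS](walk_step_cst K 1 z); apply: walk_step_le => // z'.
    by have /andP[] := f01 z'.
  - move=> z; rewrite /f'/=; congr (_ * _).
      by rewrite !indicE; congr ((nat_of_bool _)%:R)%:E; apply/idP/idP; rewrite !inE/= phit.
    by apply: eq_integral => y _ /=; rewrite addrAC (ft ((z.1 + y)%R, y)).
move=> n E FE.
have FE' : F n.+1 (E `&` Phi n.+1 @^-1` B 0%N).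
  exact: (sigma_gen_setI FE (walk_adapted (leqnn _) mBphi)).
transitivity (P ((E `&` Phi n.+1 @^-1` B 0%N) `&`
    \bigcap_i (Phi (n.+2 + i)%N @^-1` B i.+1))).
  congr (P _); rewrite -setIA; congr (_ `&` _); apply/seteqP; split => w.
    move=> h; split; first by have := h 0%N Logic.I; rewrite addn0.
    by move=> i _; have := h i.+1 Logic.I; rewrite addnS.
  move=> [h0 h] [|i] _; first by rewrite addn0.
  by rewrite addnS; exact: h.
rewrite Hf; last by apply: walk_past_mono FE'.
rewrite markov_step// integral_mkcondr; apply: eq_integral => w _.
rewrite patchE /f'/= indicE.
case: ifPn => wB.
  by rewrite (@mem_set _ (phi @^-1` B 0%N) (X n.+1 w)) ?mul1e//; exact: (set_mem wB).
rewrite (@memNset _ (phi @^-1` B 0%N) (X n.+1 w)) ?mul0e// => h.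
by move: wB; rewrite notin_setE; exact.
Qed.

Lemma phi_measurable n : measurable_fun setT (Phi n).
Proof. exact: measurableT_comp. Qed.

Lemma measurable_state n f : measurable_fun setT f ->
  measurable_fun setT (fun w => f (X n.+1 w, V n w) : \bar R).
Proof. by move=> mf; apply: measurableT_comp => //; exact/measurable_fun_pair. Qed.

(** That is, [f (X n.+1, V n)] is a version of the conditional probability of [B] given the past up
    to time [n.+1]. *)
Definition future_expectation n (B : set T) (f : mR * mR -> \bar R) :=
  forall E, F n.+1 E -> P (E `&` B) = \int[P]_(w in E) f (X n.+1 w, V n w).

(* For a disjoint union the sum of the conditional probabilities may exceed 1
   off the support of the state, whence the truncation; on the past event where
   the sum exceeds 1 along the walk, both sums have the same integral. *)
Lemma future_bigcup n (B : nat -> set T) : (forall i, measurable (B i)) ->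
  trivIset setT B ->
  (forall i, exists2 f, unit_periodic t f & future_expectation n (B i) f) ->
  exists2 f, unit_periodic t f & future_expectation n (\bigcup_i B i) f.
Proof.
move=> mB tB H.
pose f i := sval (cid2 (H i)).
have fP i : unit_periodic t (f i) by rewrite /f; case: cid2.
have fE i : future_expectation n (B i) (f i) by rewrite /f; case: cid2.
have mf i : measurable_fun setT (f i) by have [] := fP i.
have f0 i z : 0 <= f i z by have [_ /(_ z) /andP[]] := fP i.
pose s z := \sum_(i <oo) f i z.
have ms : measurable_fun setT s by exact: ge0_emeasurable_sum.
have s0 z : 0 <= s z by exact: nneseries_ge0.
have sE E : F n.+1 E ->
    P (E `&` \bigcup_i B i) = \int[P]_(w in E) s (X n.+1 w, V n w).
  move=> FE; have mE := walk_past_measurable FE.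
  rewrite setI_bigcupr measure_bigcup//=; last 2 first.
  - by move=> i _; exact: measurableI.
  - exact: trivIset_setIl.
  rewrite integral_nneseries//; last first.
    by move=> i; apply: measurable_funS (measurable_state n (mf i)).
  rewrite (@eq_eseriesl _ _ xpredT) => [|i]; last exact: in_setT.
  by apply: eq_eseriesr => i _; exact: fE.
pose f' z := mine (s z) 1.
have mf' : measurable_fun setT f' by exact: measurable_mine.
exists f'.
  split => // z; first by rewrite le_min s0 lee01/= ge_min lexx orbT.
  rewrite /f'; congr (mine _ _); apply: eq_eseriesr => i _.
  by have [_ _ ->] := fP i.
move=> E FE; have mE := walk_past_measurable FE.
have f'0 z : 0 <= f' z by rewrite le_min s0 lee01.
have mD : measurable [set z | 1 < s z].
  by rewrite -[X in measurable X]setTI; exact: emeasurable_fun_o_infty.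
pose D := [set w | 1 < s (X n.+1 w, V n w)].
have FD : F n.+1 D := walk_state_adapted mD.
have mDw := walk_past_measurable FD.
have FED : F n.+1 (E `&` D) by exact: (sigma_gen_setI FE FD).
have mED := walk_past_measurable FED.
have msE G := measurable_funS measurableT (@subsetT _ G) (measurable_state n ms).
have mf'E G := measurable_funS measurableT (@subsetT _ G) (measurable_state n mf').
rewrite sE// -(setUIDK E D) !ge0_integral_setU//; last 4 first.
- exact: measurableD.
- by rewrite disj_set2E; apply/eqP/seteqP; split => // w [] [_ ?] [].
- exact: measurableD.
- by rewrite disj_set2E; apply/eqP/seteqP; split => // w [] [_ ?] [].
congr (_ + _); last first.
  apply: eq_integral => w; rewrite inE => -[_ Dw]; rewrite /f' min_l//.
  by rewrite leNgt; apply/negP.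
(* One inequality is pointwise. For the other, the truncated sum is 1 on [D], so its integral is the
   whole probability of [E] and [D]. *)
apply/eqP; rewrite eq_le; apply/andP; split; last first.
  by apply: ge0_le_integral => // w _; rewrite ge_min lexx.
rewrite -sE//; apply: (@le_trans _ _ (P (E `&` D))).
  by apply: le_measure; rewrite ?inE//; apply: measurableI => //; exact: bigcup_measurable.
rewrite -[leLHS]mul1e -integral_cst//; apply: ge0_le_integral => // w [_ Dw].
by rewrite /f' min_r// ltW.
Qed.

(** Dynkin's theorem, starting from rectangles: complements correspond to [1 - f], disjoint unions
    to truncated sums. *)
Lemma future_expectation_exists n B : sigma_gen Phi [set i | (n < i)%N] B ->
  exists2 f, unit_periodic t f & future_expectation n B f.
Proof.
pose H := [set B | measurable B /\ exists2 f, unit_periodic t f & future_expectation n B f].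
suff : sigma_gen Phi [set i | (n < i)%N] `<=` H by move=> h /h[].
apply: sigma_gen_pi; first split.
- split => //; exists (cst 1); first by split => // z; rewrite /= lexx lee01.
  move=> E FE; rewrite integral_cst ?mul1e ?setIT//; exact: walk_past_measurable FE.
- move=> C [mC [f [mf f01 ft] fE]]; split; first exact: measurableC.
  have f0 z : 0 <= f z by have /andP[] := f01 z.
  have ffin z : f z \is a fin_num.
    by rewrite ge0_fin_numE// (@le_lt_trans _ _ 1) ?ltry//; have /andP[] := f01 z.
  have mg : measurable_fun setT (fun z => 1 - f z) by exact: emeasurable_funB.
  have g0 z : 0 <= 1 - f z by rewrite sube_ge0 ?ffin//; have /andP[] := f01 z.
  exists (fun z => 1 - f z).
    by split => // z; [rewrite g0 leeBlDr// leeDl|rewrite ft].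
  move=> E FE; have mE := walk_past_measurable FE.
  have : P E = P (E `&` C) + \int[P]_(w in E) (1 - f (X n.+1 w, V n w)).
    rewrite fE// -ge0_integralD//; last 2 first.
    - by apply: measurable_funS (measurable_state n mf).
    - by apply: measurable_funS (measurable_state n mg).
    rewrite -[LHS]mul1e -integral_cst//; apply: eq_integral => w _.
    by rewrite addeC subeK.
  rewrite -[in LHS](setUIDK E C) measureU//; last 3 first.
  - exact: measurableI.
  - exact: measurableD.
  - by apply/seteqP; split => // w [] [_ ?] [].
  have fEC : P (E `&` C) \is a fin_num by rewrite fin_num_measure//; exact: measurableI.
  rewrite -setDE ![P (E `&` C) + _]addeC => /(congr1 (fun y => y - P (E `&` C))).
  by rewrite !addeK.
- move=> B' tB' HB'; split; first by apply: bigcup_measurable => i _; have [] := HB' i.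
  by apply: future_bigcup => // i; have [] := HB' i.
- move=> _ [p [C [mC CJ Cp ->]]]; split.
    apply: bigcapT_measurable => i; exact: measurable_preimage (phi_measurable i) (mC i).
  have [i|i pi|f ft fE] := @future_rectangle p (fun i => C (n.+1 + i)%N).
  + exact: mC.
  + by apply: Cp; rewrite (leq_trans pi)// leq_addl.
  exists f => // E FE; rewrite -fE//; congr (P (_ `&` _)).
  apply/seteqP; split => w h i _; first exact: h.
  have [ni|ni] := ltnP n i; first by have := h (i - n.+1)%N Logic.I; rewrite subnKC.
  by rewrite CJ//= ltnNge ni.
Qed.

Context (C r : R).
Hypothesis oscillation : forall (f : mR * mR -> \bar R) (k : nat),
  unit_periodic t f -> exists l u : R, [/\ (0 <= l)%R, (u - l <= C * r ^+ k)%R &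
    forall z, l%:E <= iter k (walk_step K) f z <= u%:E].

(** The conditional probability of [B] given the past up to [n.+1] is a [k]-th iterate with values
    between [l] and [u]. Averaging it over [A] and over the whole space puts both [P B] and the
    probability of [B] given [A] between [l] and [u]. *)
Lemma walk_phi_mixing n k (A B : set T) : F n.+1 A ->
  sigma_gen Phi [set i | (n + k < i)%N] B ->
  `|P (A `&` B) - P A * P B| <= (C * r ^+ k)%:E * P A.
Proof.
move=> FA /future_expectation_exists[f fp fE].
have [l [u [l0 lu H]]] := oscillation k fp.
have [mf f01 ft] := fp.
have f0 z : 0 <= f z by have /andP[] := f01 z.
have bnd E : F n.+1 E -> l%:E * P E <= P (E `&` B) <= u%:E * P E.
  move=> FE; have mE := walk_past_measurable FE.
  rewrite fE; last by apply: walk_past_mono FE; rewrite ltnS leq_addr.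
  rewrite markov_iter//.
  have [L0 mL] : (forall z, 0 <= iter k (walk_step K) f z) /\
      measurable_fun setT (iter k (walk_step K) f) by exact: walk_iter_nneg.
  have mLE := measurable_funS measurableT (@subsetT _ E) (measurable_state n mL).
  rewrite -!integral_cst//; apply/andP; split; apply: ge0_le_integral => //.
  - by move=> w _; have /andP[] := H (X n.+1 w, V n w).
  - by move=> w _; have /andP[] := H (X n.+1 w, V n w).
have PA01 := probability_le1 P (walk_past_measurable FA).
have mA := walk_past_measurable FA.
have [FT PT] : F n.+1 setT /\ P setT = 1.
  by split; [exact: sigma_gen_setT|exact: probability_setT].
have := bnd _ FA; have := bnd _ FT; rewrite setTI PT !mule1.
have PAfin : P A \is a fin_num by exact: fin_num_measure.
have btw (x : \bar R) (p q : R) : p%:E <= x <= q%:E ->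
    exists2 y : R, x = y%:E & (p <= y <= q)%R.
  move: x => [y| |] => /andP[]; rewrite ?leye_eq ?leeNy_eq// !lee_fin => py yq.
  by exists y => //; rewrite py yq.
have [a aE] : exists a, P A = a%:E by exists (fine (P A)); rewrite fineK.
have a0 : (0 <= a)%R by rewrite -lee_fin -aE.
rewrite aE => /btw[pb -> /andP[lb bu]]; rewrite -!EFinM => /btw[pab -> /andP[la ua]].
rewrite -EFinB /= lee_fin ler_norml.
have : (a * l <= a * pb)%R by exact: ler_wpM2l.
have : (a * pb <= a * u)%R by exact: ler_wpM2l.
have := ler_wpM2l a0 lu; rewrite mulrBr => h1 h2 h3.
by apply/andP; split; lra.
Qed.

End markov_walk.

(** * The two models *)

Section integral_dynkin.
Local Open Scope ereal_scope.
Context d (T : measurableType d) (R : realType) (P : probability T R).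

(** Both sides are finite measures in [E], with equal total mass by the last hypothesis. *)
Lemma dynkin_eq_integral (W : set T) (f : T -> \bar R) : measurable W ->
  measurable_fun setT f -> (forall x, 0 <= f x) -> P W = \int[P]_x f x ->
  dynkin [set E | measurable E /\ P (E `&` W) = \int[P]_(w in E) f w].
Proof.
move=> mW mf f0 PW; split.
- by split => //; rewrite setTI.
- move=> E [mE EW]; split; first exact: measurableC.
  have fEW : P (E `&` W) \is a fin_num by rewrite fin_num_measure//; exact: measurableI.
  have : P (E `&` W) + P (~` E `&` W) = P (E `&` W) + \int[P]_(w in ~` E) f w.
    rewrite [in RHS]EW -ge0_integral_setU//; last 3 first.
    - exact: measurableC.
    - by rewrite setUv.
    - by rewrite disj_set2E setICr.
    rewrite setUv -PW -measureU//.
    - by rewrite -setIUl setUv setTI.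
    - exact: measurableI.
    - by apply: measurableI => //; exact: measurableC.
    - by apply/seteqP; split => // w [] [? _] [].
  rewrite ![P (E `&` W) + _]addeC => /(congr1 (fun y => y - P (E `&` W))).
  by rewrite !addeK.
- move=> F tF HF; have mF i : measurable (F i) by have [] := HF i.
  split; first exact: bigcup_measurable.
  rewrite ge0_integral_bigcup//; last exact: measurable_funS mf.
  rewrite setI_bigcupl measure_bigcup//=; last 2 first.
  - by move=> i _; exact: measurableI.
  - exact: trivIset_setIr.
  rewrite (@eq_eseriesl _ _ xpredT) => [|i]; last exact: in_setT.
  by apply: eq_eseriesr => i _; have [] := HF i.
Qed.

End integral_dynkin.

Section markov_start.
Local Open Scope ereal_scope.
Context (R : realType).
Local Notation mR := (measurableTypeR R).
Context d (T : measurableType d) (P : probability T R) (X V : nat -> T -> mR).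
Context (K : R.-pker mR ~> mR).
Hypothesis mX0 : measurable_fun setT (X 0%N).
Hypothesis mV : forall n, measurable_fun setT (V n).

Lemma measurable_kernel_state n (A : set mR) : measurable A ->
  measurable_fun setT (fun w => K (V n w) A).
Proof.
by move=> mA; exact: (measurableT_comp (measurable_kernel K A mA) (mV n)).
Qed.

(** Both integrals can be taken over the image under [V n]. The restricted laws of [V n] there are
    proportional, because [E] cut with a condition on [V n] is an event of the process [V]. *)
Lemma indep_integral n (B A : set mR) (E : set T) : indep_of_process P (X 0%N) V ->
  measurable B -> measurable A -> sigma_gen V `I_n.+1 E ->
  \int[P]_(w in X 0%N @^-1` B `&` E) K (V n w) A =
  P (X 0%N @^-1` B) * \int[P]_(w in E) K (V n w) A.
Proof.
move=> indep mB mA FE.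
have mE : measurable E by apply: sigma_gen_measurable FE => j _; exact: mV.
have mXB : measurable (X 0%N @^-1` B) by exact: measurable_preimage.
have mXE := measurableI _ _ mXB mE.
have fXB : P (X 0%N @^-1` B) \is a fin_num by exact: fin_num_measure.
have c0 : (0 <= fine (P (X 0%N @^-1` B)))%R by exact: fine_ge0.
pose c : {nonneg R} := NngNum c0.
have cE : P (X 0%N @^-1` B) = (c%:num)%:E by rewrite /= fineK.
have mK : measurable_fun setT (K ^~ A) by exact: measurable_kernel.
have mKV := measurable_kernel_state n mA.
rewrite -(ge0_integral_mrestr _ mXE)// -(ge0_integral_mrestr _ mE)//.
have push (G : set T) (mG : measurable G) : \int[mrestr P mG]_w K (V n w) A =
    \int[pushforward (mrestr P mG) (V n)]_v K v A.
  by rewrite ge0_integral_pushforward ?preimage_setT.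
rewrite !push cE -ge0_integral_mscale//.
apply: eq_measure_integral => D mD _.
rewrite /= /mscale/= /pushforward /mrestr -cE.
have [D' cD' ->] := sigma_gen_path_event
  (sigma_gen_preimage (X := V) (J := setT) (j := n) Logic.I mD).
have [E' cE' EE'] := sigma_gen_path_event FE.
rewrite [in X in _ `&` (_ `&` X)]EE' [in X in _ * P (_ `&` X)]EE'.
have cI : cylinder_sigma (D' `&` E').
  exact: (sigma_gen_setI cD' (sigma_gen_cylinder cE')).
by rewrite setIA [_ `&` (X 0%N @^-1` B)]setIC -setIA; exact: (indep B (D' `&` E') mB cI).
Qed.

(** A condition on [X 0] cut with an event of [V 0], ..., [V n] factors, by independence, on both
    sides of the Markov property. Such intersections form a pi-system generating the past. *)
Lemma markov_chain_start n E (A : set mR) : indep_of_process P (X 0%N) V ->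
  markov_chain P V K -> sigma_gen (walk_inputs X V) `I_n.+2 E -> measurable A ->
  P (E `&` V n.+1 @^-1` A) = \int[P]_(w in E) K (V n w) A.
Proof.
move=> indep mc FE mA.
have mW : measurable (V n.+1 @^-1` A) by exact: measurable_preimage.
pose H := [set E | measurable E /\ P (E `&` V n.+1 @^-1` A) = \int[P]_(w in E) K (V n w) A].
suff : H E by case.
have sT := @sigma_gen_setT _ _ _ V `I_n.+1.
have dH : dynkin H.
  apply: dynkin_eq_integral => //; first exact: measurable_kernel_state.
  by rewrite -(mc _ _ _ mA sT) setTI.
pose G := [set E | exists (B : set mR) E', [/\ measurable B, sigma_gen V `I_n.+1 E' &
  E = X 0%N @^-1` B `&` E']].
have GI : setI_closed G.
  move=> _ _ [B [E1 [mB FE1 ->]]] [C [E2 [mC FE2 ->]]].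
  exists (B `&` C), (E1 `&` E2); split; first exact: measurableI.
    exact: sigma_gen_setI.
  by rewrite preimage_setI setIACA.
have GH : G `<=` H.
  move=> _ [B [E' [mB FE' ->]]].
  have mE' : measurable E' by apply: sigma_gen_measurable FE' => j _; exact: mV.
  split; first by apply: measurableI => //; exact: measurable_preimage.
  rewrite indep_integral// -mc// -setIA.
  have FW : sigma_gen V setT (E' `&` V n.+1 @^-1` A).
    apply: sigma_gen_setI; last exact: sigma_gen_preimage.
    exact: sigma_gen_mono FE'.
  by have [D cD ->] := sigma_gen_path_event FW; exact: indep.
suff : sigma_gen (walk_inputs X V) `I_n.+2 `<=` <<s G >>.
  by move=> /(_ _ FE); exact: pi_dynkin_sub.
apply: sigma_gen_sub => [|[|j] B /= jn mB]; first exact: smallest_sigma_algebra.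
  apply: sub_sigma_algebra; exists B, setT; split => //; by rewrite setIT.
apply: sub_sigma_algebra; exists setT, (V j @^-1` B); split => //.
  exact: sigma_gen_preimage.
by rewrite preimage_setT setTI.
Qed.

End markov_start.

(** What the two models share. The iterate is the probability that the last of [M] steps lies in
    []a, b[]; its lower bound is uniform over all real states. *)
Definition regenerative (R : realType)
    (K : R.-pker (measurableTypeR R) ~> (measurableTypeR R)) : Prop :=
  exists (a b c d0 : R) (M : nat), [/\ a < b, 0 < c,
    (forall v (A : set (measurableTypeR R)), `]a, b[%classic v -> measurable A ->
       A `<=` `]a, b[ -> (c%:E * lebesgue_measure A <= K v A)%E),
    0 < d0 &
    forall z, (d0%:E <= iter M (walk_step K)
      (fun z : measurableTypeR R * measurableTypeR R => (\1_(`]a, b[%classic) z.2)%:E) z)%E].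

(** * Independent and identically distributed steps *)

Section iid.
Local Open Scope ereal_scope.
Context (R : realType) d (T : measurableType d) (P : probability T R).
Local Notation mR := (measurableTypeR R).
Context (V : nat -> T -> mR).
Hypothesis mV : forall n, measurable_fun setT (V n).

Let V0 : {mfun T >-> mR} := HB.pack (V 0%N) (isMeasurableFun.Build _ _ _ _ _ (mV 0%N)).

Definition iid_kernel : R.-pker mR ~> mR :=
  kprobability (measurable_cst ((distribution P V0 : probability mR R) : pprobability mR R)).

(** On a rectangle in [V 0], ..., [V n], a further condition on [V n.+1] appends one factor to a
    finite product, and rectangles suffice by Dynkin's theorem. *)
Lemma iid_markov_chain : mutually_independent P V ->
  (forall n (A : set mR), measurable A -> P (V n @^-1` A) = P (V 0%N @^-1` A)) ->
  markov_chain P V iid_kernel.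
Proof.
move=> indep same n A E mA FE.
have mW : measurable (V n.+1 @^-1` A) by exact: measurable_preimage.
have PW : P (V n.+1 @^-1` A) = P (V 0%N @^-1` A) by exact: same.
pose H := [set E | measurable E /\ P (E `&` V n.+1 @^-1` A) =
  \int[P]_(w in E) iid_kernel (V n w) A].
suff : H E by case.
move: E FE; apply: sigma_gen_pi.
  apply: dynkin_eq_integral => //=.
  by rewrite integral_cst// [X in _ * X](probability_setT P) mule1.
move=> _ [p [B [mB BJ _ ->]]].
have mE : measurable (\bigcap_i (V i @^-1` B i)).
  by apply: bigcapT_measurable => i; exact: measurable_preimage.
split => //; rewrite /= integral_cst//= -PW.
pose J m : {fset nat} := [fset i in iota 0 m]%fset.
have JE m i : (i \in J m) = (i < m)%N by rewrite !inE/= mem_iota.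
pose B' i := if i == n.+1 then A else B i.
have mB' i : measurable (B' i) by rewrite /B'; case: ifP.
have E1 : \bigcap_i (V i @^-1` B i) = \bigcap_(i in [set` J n.+1]) (V i @^-1` B i).
  apply/seteqP; split => w h i; first by move=> _; exact: h.
  move=> _; have [ni|ni] := ltnP i n.+1; first by apply: h; rewrite /= JE.
  by rewrite BJ//= ltnNge ni.
have E2 : \bigcap_i (V i @^-1` B i) `&` V n.+1 @^-1` A =
    \bigcap_(i in [set` J n.+2]) (V i @^-1` B' i).
  apply/seteqP; split => w.
    by move=> [h hA] i _; rewrite /B'; case: eqP => [->//|_]; exact: h.
  move=> h; split; last by have := h n.+1; rewrite /B' eqxx; apply; rewrite /= JE.
  move=> i _; have [ni|ni] := ltnP i n.+1; last by rewrite BJ//= ltnNge ni.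
  have := h i; rewrite /B' ltn_eqF//; apply; rewrite /= JE.
  exact: ltnW.
rewrite E2 indep// [in RHS]E1 indep//.
have Jperm m : perm_eq (J m) (iota 0 m).
  apply: uniq_perm; [exact: fset_uniq|exact: iota_uniq|].
  by move=> i; rewrite JE mem_iota.
have iotaS : iota 0 n.+2 = iota 0 n.+1 ++ [:: n.+1] by rewrite -addn1 iotaD add0n.
rewrite !(perm_big _ (Jperm _)) iotaS big_cat big_seq1.
rewrite /B' eqxx muleC; congr (_ * _).
rewrite big_seq [in RHS]big_seq; apply: eq_bigr => i.
by rewrite mem_iota add0n => /andP[_ ni]; rewrite ltn_eqF.
Qed.

Lemma iid_regenerative (a b c : R) : (a < b)%R -> (0 < c)%R ->
  (forall A : set mR, measurable A -> A `<=` `]a, b[ ->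
     c%:E * lebesgue_measure A <= P (V 0%N @^-1` A)) ->
  regenerative iid_kernel.
Proof.
move=> ab c0 H.
have lJ : lebesgue_measure `]a, b[%classic = (b - a)%:E.
  by rewrite lebesgue_measure_itv/= lte_fin ab.
exists a, b, c, (c * (b - a))%R, 1%N; split => //.
- by move=> v A _ mA AJ; exact: H.
- by rewrite mulr_gt0// subr_gt0.
move=> z; rewrite /= /walk_step/= integral_indic// setIT EFinM -lJ.
exact: H.
Qed.

End iid.

(** * Markovian steps in a compact interval *)

Section model2.
Local Open Scope ereal_scope.
Context (R : realType).
Local Notation mR := (measurableTypeR R).
Local Notation leb := (@lebesgue_measure R).
Context (vmin vmax : R).
Hypothesis (vv : (vmin < vmax)%R).

(* Composing K with [clamp] makes the minorization hold from every real state,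
   without changing K on the states that the chain visits. *)
Definition clamp (v : mR) : mR := Num.max vmin (Num.min vmax v).

Lemma measurable_clamp : measurable_fun setT clamp.
Proof.
by apply: measurable_maxr => //; exact: measurable_minr.
Qed.

Lemma clamp_itv v : clamp v \in `[vmin, vmax].
Proof. by rewrite in_itv/= /clamp le_max lexx/= ge_max (ltW vv)/= ge_min lexx. Qed.

Lemma clamp_id v : v \in `[vmin, vmax] -> clamp v = v.
Proof. by rewrite in_itv/= /clamp => /andP[h1 h2]; rewrite min_r// max_r. Qed.

Lemma clamp_le v : (vmin <= v)%R -> (clamp v <= v)%R.
Proof. by move=> h; rewrite ge_max h/= ge_min lexx orbT. Qed.

Context (K : R.-pker mR ~> mR) (f : R -> R -> R) (eta mu0 : R).
Hypothesis (eta0 : (0 < eta)%R) (mu00 : (0 < mu0)%R).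
Hypothesis Kf : forall v, v \in `[vmin, vmax] ->
  [/\ measurable_fun `[vmin, vmax] (f v),
      (forall x, x \in `[vmin, vmax] -> 0 <= f v x)%R &
      forall A : set mR, measurable A ->
        K v A = \int[leb]_(x in A `&` `[vmin, vmax]) (f v x)%:E].
Hypothesis fmu : forall v x, v \in `[vmin, vmax] -> x \in `[vmin, vmax] ->
  x \in `[v - eta, v + eta]%R -> (mu0 <= f v x)%R.

Lemma density_lower_bound v (A : set mR) : v \in `[vmin, vmax] -> measurable A ->
  A `<=` `[vmin, vmax] -> A `<=` `[(v - eta)%R, (v + eta)%R] -> mu0%:E * leb A <= K v A.
Proof.
move=> vI mA AI Av; have [mf f0 ->//] := Kf vI.
rewrite setIidl//; apply: ge0_cst_le_integral => //.
- by apply/measurable_EFinP; exact: measurable_funS mf.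
- by rewrite lee_fin ltW.
- by move=> x Ax; rewrite lee_fin; apply: fmu => //; [exact: AI|exact: Av].
Qed.

Local Notation K' := (kprecomp K measurable_clamp).

(** The chain can be driven down to [J], at the bottom of its interval: from [v], the next value
    falls with probability at least [e] in an interval of length [d] with upper end the larger of
    [v - d] and [vmin + d]. From [J] this target is [J] again, so one number of steps serves all
    starting states. *)
Lemma model2_regenerative : regenerative K'.
Proof.
(* The target reaches at most [2 * d] below [v], within the range [eta] of the density bound, and it
   fits into the interval. *)
pose d := (Num.min eta (vmax - vmin) / 2)%R.
have dm0 : (0 < Num.min eta (vmax - vmin))%R by rewrite lt_min eta0 subr_gt0.
have d0 : (0 < d)%R by rewrite divr_gt0.
have deta : (2 * d <= eta)%R by rewrite mulrC divfK// ge_min lexx.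
have dv : (2 * d <= vmax - vmin)%R by rewrite mulrC divfK// ge_min lexx orbT.
pose J : set mR := `]vmin, (vmin + d)%R[%classic.
pose g (z : mR * mR) : \bar R := (\1_J z.2)%:E.
have mJ : measurable J by exact: measurable_itv.
have mg : measurable_fun setT g.
  by apply/measurable_EFinP; exact: (measurableT_comp (measurable_indic mJ)).
have g0 z : 0 <= g z by rewrite lee_fin.
pose e := (mu0 * d)%R.
have e0 : (0 < e)%R by rewrite mulr_gt0.
have step k z : (forall z, (vmin < z.2)%R -> (z.2 < vmin + k.+1%:R * d)%R ->
      (e ^+ k)%:E <= iter k (walk_step K') g z) ->
    (clamp z.2 < vmin + k.+2%:R * d)%R ->
    (e ^+ k.+1)%:E <= iter k.+1 (walk_step K') g z.
  move=> IH zk; rewrite iterS /walk_step.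
  have [L0 mL] := walk_iter_nneg K' k g0 mg.
  set G := iter k (walk_step K') g in IH L0 mL *.
  have mGz := measurable_walk_arg z mL.
  set v := clamp z.2; have vI : v \in `[vmin, vmax] := clamp_itv _.
  pose s := Num.max vmin (v - 2 * d)%R.
  pose S : set mR := `]s, (s + d)%R[%classic.
  have mS : measurable S by exact: measurable_itv.
  have [s1 s2] : (vmin <= s)%R /\ (v - 2 * d <= s)%R.
    by rewrite !le_max !lexx orbT.
  have vv' : (vmin <= v <= vmax)%R by move: vI; rewrite in_itv.
  have k1 : (k.+1%:R * d + d = k.+2%:R * d :> R)%R by rewrite -[in RHS]natr1 mulrDl mul1r.
  have k2 : (0 <= k%:R * d :> R)%R by rewrite mulr_ge0// ltW.
  have k3 : (k%:R * d + d = k.+1%:R * d :> R)%R by rewrite -[in RHS]natr1 mulrDl mul1r.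
  have zk' : (v < vmin + k.+2%:R * d)%R by exact: zk.
  have s3 : (s + d <= vmin + k.+1%:R * d)%R.
    by rewrite -lerBrDr ge_max; apply/andP; split; lra.
  have s4 : (s + d <= vmax)%R by rewrite -lerBrDr ge_max; apply/andP; split; lra.
  have s5 : (s <= v)%R by rewrite ge_max; apply/andP; split; lra.
  have KS : mu0%:E * leb S <= K' z.2 S.
    apply: density_lower_bound => // y; rewrite /S /= !in_itv/= => /andP[? ?].
      by apply/andP; split; lra.
    by rewrite -/v; apply/andP; split; lra.
  have lS : leb S = d%:E.
    rewrite lebesgue_measure_itv/= lte_fin ltrDl d0.
    by rewrite -EFinB addrAC subrr add0r.
  apply: (@le_trans _ _ (\int[K' z.2]_(y in S) G ((z.1 + y)%R, y))); last first.
    by apply: ge0_subset_integral.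
  rewrite exprSr EFinM; apply: (@le_trans _ _ ((e ^+ k)%:E * K' z.2 S)).
    by apply: lee_wpmul2l; [rewrite lee_fin exprn_ge0// ltW|rewrite /e EFinM -lS].
  apply: ge0_cst_le_integral => //.
  - exact: measurable_funS mGz.
  - by rewrite lee_fin exprn_ge0// ltW.
  - move=> y; rewrite /S /= in_itv/= => /andP[? ?].
    by apply: IH => /=; lra.
have iterJ k z : (vmin < z.2)%R -> (z.2 < vmin + k.+1%:R * d)%R ->
    (e ^+ k)%:E <= iter k (walk_step K') g z.
  elim: k z => [|k IH] z z1 z2.
    rewrite expr0 /g /= indicE mem_set// /J /= in_itv/= z1/=.
    by rewrite mul1r in z2.
  apply: step => //; apply: le_lt_trans z2; exact/clamp_le/ltW.
pose k := Num.truncn ((vmax - vmin) / d).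
have kv : (vmax < vmin + k.+2%:R * d)%R.
  have : ((vmax - vmin) / d < k.+1%:R)%R by exact: truncnS_gt.
  rewrite ltr_pdivrMr// => h.
  by rewrite -[k.+2%:R]natr1 mulrDl mul1r; lra.
exists vmin, (vmin + d)%R, mu0, (e ^+ k.+1)%R, k.+1; split => //.
- by rewrite ltrDl.
- move=> v A /= vJ mA AJ.
  have vI : v \in `[vmin, vmax].
    by move: vJ; rewrite !in_itv/= => /andP[? ?]; apply/andP; split; lra.
  rewrite /kprecomp clamp_id//; apply: density_lower_bound => // y /AJ;
    move: vJ; rewrite /= !in_itv/= => /andP[? ?] /andP[? ?]; apply/andP; split; lra.
- by rewrite exprn_gt0.
(* The first step starts from an arbitrary real state, possibly outside the scope of [iterJ]; [step]
   only looks at its clamped value, which is at most [vmax]. *)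
move=> z; apply: (step _ _ (iterJ k)); refine (le_lt_trans _ kv).
by have := clamp_itv z.2; rewrite in_itv => /andP[].
Qed.

End model2.

Lemma model2_kernel (R : realType) (d : measure_display) (T : measurableType d)
    (P : probability T R) (vmin vmax : R) (V : nat -> {RV P >-> R}) :
  vmin < vmax -> model2 vmin vmax V ->
  exists2 K : R.-pker (measurableTypeR R) ~> (measurableTypeR R),
    markov_chain P V K & regenerative K.
Proof.
move=> vv [VI [K [f [mc Kf [eta [mu0 [eta0 mu00 fmu]]] _]]]].
exists (kprecomp K (measurable_clamp vmin vmax)).
  move=> n A E mA FE; rewrite mc//.
  by apply: eq_integral => w _; rewrite /= /kprecomp clamp_id.
exact: (model2_regenerative vv eta0 mu00 Kf fmu).
Qed.

Lemma model1_kernel (R : realType) (d : measure_display) (T : measurableType d)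
    (P : probability T R) (V : nat -> {RV P >-> R}) : model1 V ->
  exists2 K : R.-pker (measurableTypeR R) ~> (measurableTypeR R),
    markov_chain P V K & regenerative K.
Proof.
move=> [indep same _ [a [b [c [a0 ab c0 H]]]]].
pose mV n : measurable_fun setT (V n : T -> measurableTypeR R) := measurable_funPT (V n).
exists (iid_kernel P mV); first exact: iid_markov_chain.
exact: iid_regenerative ab c0 H.
Qed.

(** * From uniform mixing to beta-mixing *)

Section monotone_extension.
Local Open Scope ereal_scope.

Lemma setring_bigcup_sigma_algebra (T : Type) (G : nat -> set (set T)) :
  (forall n, sigma_algebra setT (G n)) ->
  (forall m n, (m <= n)%N -> G m `<=` G n) -> setring (\bigcup_n G n).
Proof.
move=> sG ndG.
have GI A B : (\bigcup_n G n) A -> (\bigcup_n G n) B -> exists n, G n A /\ G n B.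
  move=> [m _ GA] [n _ GB]; exists (maxn m n).
  by split; [apply: (ndG m) GA|apply: (ndG n) GB]; rewrite ?leq_maxl ?leq_maxr.
have GC n A : G n A -> G n (~` A).
  by have [_ h _] := sG n; rewrite -setTD; exact: h.
split.
- by exists 0%N => //; have [] := sG 0%N.
- move=> A B GA GB; have [n [GnA GnB]] := GI _ _ GA GB; exists n => //.
  rewrite -[A `|` B]setCK setCU; apply: (GC).
  by apply: sigma_algebraI => //; exact: GC.
- move=> A B GA GB; have [n [GnA GnB]] := GI _ _ GA GB; exists n => //.
  by rewrite setDE; apply: sigma_algebraI => //; exact: GC.
Qed.

Lemma sigma_algebra_g_sigma_ring (T : Type) (G : set (set T)) :
  G setT -> sigma_algebra setT <<sr G>>.
Proof.
move=> GT; have [s0 sD sU] := smallest_sigma_ring G.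
split => // A sA; apply: (sD) => //; exact: sub_g_sigma_ring.
Qed.

Context d (T : measurableType d) (R : realType).

(** Inequalities between measures pass to monotone limits, decreasing ones by finiteness, but not to
    complements; hence monotone classes over a ring instead of Dynkin systems. *)
Lemma le_measure_g_sigma_ring (m1 m2 : {measure set T -> \bar R}) (G : set (set T)) :
  setring G -> G `<=` measurable -> m1 setT < +oo -> m2 setT < +oo ->
  (forall A, G A -> m1 A <= m2 A) -> forall A, <<sr G>> A -> m1 A <= m2 A.
Proof.
move=> rG mG m1oo m2oo H A.
have moo (m : {measure set T -> \bar R}) (B : set T) : m setT < +oo -> measurable B -> m B < +oo.
  by move=> moo mB; apply: le_lt_trans moo; apply: le_measure; rewrite ?inE.
pose M := [set A | measurable A /\ m1 A <= m2 A].
suff : <<sr G>> `<=` M by move=> /[apply] -[].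
apply: monotone_setring_sub_g_sigma_ring => //; last first.
  by move=> B GB; split; [exact: mG|exact: H].
split => F mon MF.
- have mF i : measurable (F i) by have [] := MF i.
  have mU : measurable (\bigcup_i F i) by exact: bigcupT_measurable.
  split => //.
  have c1 := nondecreasing_cvg_mu (mu := m1) mF mU mon.
  have c2 := nondecreasing_cvg_mu (mu := m2) mF mU mon.
  rewrite -(cvg_lim _ c1)// -(cvg_lim _ c2)//.
  apply: lee_lim; [by apply/cvg_ex; eexists; exact: c1|by apply/cvg_ex; eexists; exact: c2|].
  by apply: nearW => n; have [] := MF n.
- have mF i : measurable (F i) by have [] := MF i.
  have mU : measurable (\bigcap_i F i) by exact: bigcapT_measurable.
  split => //.
  have c1 := nonincreasing_cvg_mu (mu := m1) (moo _ _ m1oo (mF 0%N)) mF mU mon.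
  have c2 := nonincreasing_cvg_mu (mu := m2) (moo _ _ m2oo (mF 0%N)) mF mU mon.
  rewrite -(cvg_lim _ c1)// -(cvg_lim _ c2)//.
  apply: lee_lim; [by apply/cvg_ex; eexists; exact: c1|by apply/cvg_ex; eexists; exact: c2|].
  by apply: nearW => n; have [] := MF n.
Qed.

(** With [a], [p] and [c] the probabilities of two events and of their intersection, each half
    compares two measures of the first event. *)
Lemma abse_mixing_iff (c a p e : R) :
  `|c%:E - a%:E * p%:E| <= e%:E * a%:E <->
  c%:E <= (p + e)%:E * a%:E /\ p%:E * a%:E <= c%:E + e%:E * a%:E.
Proof.
rewrite -!EFinM -EFinB -EFinD !lee_fin ler_norml; split.
  by move=> /andP[h1 h2]; split; lra.
by move=> [h1 h2]; apply/andP; split; lra.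
Qed.

Lemma mixing_g_sigma_ring (P : probability T R) (G : set (set T)) (B : set T) (e : R) :
  (0 <= e)%R -> measurable B -> setring G -> G `<=` measurable ->
  (forall A, G A -> `|P (A `&` B) - P A * P B| <= e%:E * P A) ->
  forall A, measurable A -> <<sr G>> A -> `|P (A `&` B) - P A * P B| <= e%:E * P A.
Proof.
move=> e0 mB rG mG H.
have PB : P B \is a fin_num by exact: fin_num_measure.
pose p := fine (P B).
have pE : P B = p%:E by rewrite fineK.
have p0 : (0 <= p)%R by exact: fine_ge0.
have pe0 : (0 <= p + e)%R by exact: addr_ge0.
pose e' : {nonneg R} := NngNum e0; pose p' : {nonneg R} := NngNum p0.
pose pe' : {nonneg R} := NngNum pe0.
have PT : P setT = 1 by exact: probability_setT.
have red A : measurable A -> (`|P (A `&` B) - P A * P B| <= e%:E * P A <->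
    mrestr P mB A <= mscale pe' P A /\
    mscale p' P A <= measure_add (mrestr P mB) (mscale e' P) A).
  move=> mA; rewrite measure_addE /= /mscale/= /mrestr pE.
  have PA : P A \is a fin_num by exact: fin_num_measure.
  have PAB : P (A `&` B) \is a fin_num by rewrite fin_num_measure//; exact: measurableI.
  rewrite -(fineK PA) -(fineK PAB).
  exact: (abse_mixing_iff (fine (P (A `&` B))) (fine (P A)) p e).
have fP (c : {nonneg R}) : mscale c P setT < +oo by rewrite /mscale/= PT mule1 ltry.
have fB : mrestr P mB setT < +oo by rewrite /mrestr setTI pE ltry.
move=> A mA GA; apply/red => //; split.
  apply: (le_measure_g_sigma_ring rG mG fB (fP _)) => // D GD.
  by have [] := (red D (mG _ GD)).1 (H _ GD).
have fA : measure_add (mrestr P mB) (mscale e' P) setT < +oo.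
  by rewrite measure_addE; apply: lte_add_pinfty => //; exact: fP.
apply: (le_measure_g_sigma_ring rG mG (fP _) fA) => // D GD.
by have [] := (red D (mG _ GD)).1 (H _ GD).
Qed.

End monotone_extension.

(** * Summation over the blocks of two partitions *)

Section beta_bound.
Local Open Scope ereal_scope.
Context d (T : measurableType d) (R : realType) (P : probability T R).

(** The defect [D] is additive, so the blocks on which it is nonnegative merge into a single event
    of [S], and so do the others; each of the two groups contributes at most [e] times [P A]. *)
Lemma sum_mixing (S : set (set T)) (A : set T) (B : nat -> set T) (e : R) (n : nat) :
  sigma_algebra setT S -> S `<=` measurable -> measurable A ->
  (forall i, S (B i)) -> trivIset setT B ->
  (forall D, S D -> `|P (A `&` D) - P A * P D| <= e%:E * P A) ->
  \sum_(0 <= j < n) `|P (A `&` B j) - P A * P (B j)| <= (2 * e)%:E * P A.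
Proof.
move=> sS mS mA SB tB H.
have mB i : measurable (B i) by exact/mS.
pose D (D : set T) : R := (fine (P (A `&` D)) - fine (P A) * fine (P D))%R.
have DE E : measurable E -> P (A `&` E) - P A * P E = (D E)%:E.
  move=> mE; rewrite /D EFinB EFinM !fineK// fin_num_measure//; exact: measurableI.
have HD E : S E -> (`|D E| <= e * fine (P A))%R.
  move=> SE; rewrite -lee_fin EFinM fineK ?fin_num_measure//.
  by have := H E SE; rewrite DE//; exact: mS.
have D0 : D set0 = 0%R by rewrite /D setI0 measure0/= mulr0 subrr.
have DU E E' : measurable E -> measurable E' -> E `&` E' = set0 -> D (E `|` E') = (D E + D E')%R.
  move=> mE mE' EE'; rewrite /D setIUr !measureU//; last 3 first.
  - exact: measurableI.
  - exact: measurableI.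
  - by rewrite setIACA EE' setI0.
  have fm X : measurable X -> P X \is a fin_num by move=> mX; exact: fin_num_measure.
  rewrite !fineD ?fm//; [by ring|exact: measurableI..].
have mU (Q : pred nat) m : measurable (\bigcup_(j in [set j | (j < m)%N && Q j]) B j).
  by apply: bigcup_measurable.
have sumD (Q : pred nat) : (\sum_(0 <= j < n | Q j) D (B j) =
    D (\bigcup_(j in [set j | (j < n)%N && Q j]) B j))%R.
  elim: n => [|n IH].
    by rewrite big_geq// (_ : \bigcup_(j in _) _ = set0)// bigcup0.
  rewrite big_mkcond big_nat_recr//= -big_mkcond/= IH.
  have -> : \bigcup_(j in [set j | (j < n.+1)%N && Q j]) B j =
      (\bigcup_(j in [set j | (j < n)%N && Q j]) B j) `|` (if Q n then B n else set0).
    apply/seteqP; split => w.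
      move=> [j /= /andP[jn Qj] Bj]; move: jn; rewrite ltnS leq_eqVlt => /predU1P[jn|jn].
        by right; rewrite -jn Qj.
      by left; exists j => //=; rewrite jn Qj.
    move=> [[j /= /andP[jn Qj] Bj]|]; first by exists j => //=; rewrite ltnS (ltnW jn) Qj.
    by case: ifP => // Qn Bn; exists n => //=; rewrite ltnSn Qn.
  case: ifP => Qn; last by rewrite setU0 addr0.
  rewrite DU//; apply/seteqP; split => // w [[j /= /andP[jn _] Bj] Bn].
  have := tB j n Logic.I Logic.I; rewrite /= => h.
  have jE : j = n by apply: h; exists w.
  by rewrite jE ltnn in jn.
have SU (Q : pred nat) : S (\bigcup_(j in [set j | (j < n)%N && Q j]) B j).
  rewrite bigcup_mkcond; have [S0 _ SU] := sS; apply: SU => i; by case: ifP.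
rewrite (eq_bigr (fun j => `|D (B j)|%:E)); last by move=> j _; rewrite DE.
rewrite sumEFin -(fineK (fin_num_measure P _ mA)) -EFinM lee_fin.
rewrite (bigID (fun j => 0 <= D (B j))%R)/=.
have -> : (\sum_(0 <= j < n | (0 <= D (B j))%R) `|D (B j)| =
    \sum_(0 <= j < n | (0 <= D (B j))%R) D (B j))%R.
  by apply: eq_bigr => j Dj; rewrite ger0_norm.
have -> : (\sum_(0 <= j < n | ~~ (0 <= D (B j))%R) `|D (B j)| =
    - \sum_(0 <= j < n | ~~ (0 <= D (B j))%R) D (B j))%R.
  by rewrite -sumrN; apply: eq_bigr => j; rewrite -ltNge => Dj; rewrite ltr0_norm.
rewrite !sumD.
have := HD _ (SU (fun j => 0 <= D (B j))%R).
have := HD _ (SU (fun j => ~~ (0 <= D (B j)))%R).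
by rewrite !ler_norml => /andP[? ?] /andP[? ?]; lra.
Qed.

Lemma double_sum_mixing (S : set (set T)) (A B : nat -> set T) (e : R) : (0 <= e)%R ->
  sigma_algebra setT S -> S `<=` measurable -> (forall i, measurable (A i)) ->
  trivIset setT A -> (forall i, S (B i)) -> trivIset setT B ->
  (forall i D, S D -> `|P (A i `&` D) - P (A i) * P D| <= e%:E * P (A i)) ->
  \sum_(0 <= i <oo) \sum_(0 <= j <oo) `|P (A i `&` B j) - P (A i) * P (B j)| <= (2 * e)%:E.
Proof.
move=> e0 sS mS mA tA SB tB H.
have e20 : (0 <= 2 * e)%R by rewrite mulr_ge0.
apply: (@le_trans _ _ (\sum_(0 <= i <oo) (2 * e)%:E * P (A i))).
  apply: lee_nneseries => [i _ _|i _]; first exact: nneseries_ge0.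
  apply: lime_le; first exact: is_cvg_nneseries.
  by apply: nearW => n; exact: (sum_mixing n sS mS (mA i) SB tB (H i)).
rewrite nneseriesZl//.
rewrite -[leRHS]mule1 lee_wpmul2l ?lee_fin//.
have -> : \sum_(0 <= i <oo) P (A i) = P (\bigcup_i A i).
  rewrite measure_bigcup//; apply: eq_eseriesl => i; exact/esym/in_setT.
by apply: probability_le1; exact: bigcupT_measurable.
Qed.

End beta_bound.

Lemma beta_mixing_le (R : realType) d (T : measurableType d) (P : probability T R)
    (Z : int -> T -> R) (k : nat) (e : R) : (0 <= e)%R ->
  (forall j, measurable_fun setT (Z j)) ->
  (forall A B, sigma_gen Z [set j : int | (j <= 0)%R] A ->
    sigma_gen Z [set j : int | (k%:Z <= j)%R] B ->
    (`|P (A `&` B) - P A * P B| <= e%:E * P A)%E) ->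
  (beta_mixing P Z k <= e%:E)%E.
Proof.
move=> e0 mZ H; rewrite /beta_mixing.
have h2 : (0 < 2^-1 :> R)%R by rewrite invr_gt0.
(* The factor 1/2 in the coefficient cancels the 2 coming from the two signs. *)
have -> : e%:E = ((2^-1)%:E * (2 * e)%:E)%E by rewrite -EFinM mulrA mulVf ?mul1r.
rewrite lee_pmul2l//; apply: ge_ereal_sup => _ [A [B [[SA tA _] [SB tB _] ->]]].
have mJ J : sigma_gen Z J `<=` measurable by apply: sigma_gen_measurable => j _; exact: mZ.
apply: (double_sum_mixing e0 (sigma_gen_sigma_algebra _ _) (mJ _)) => //.
- by move=> i; exact: mJ (SA i).
- by move=> i D; exact: H.
Qed.

(** A cylinder of one-sided paths pulls back to one of two-sided paths, where stationarity applies.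
    Read from any negative time on, [Z] thus has the law of the one-sided process. *)
Lemma same_law_shift (R : realType) (d d' : measure_display)
    (T : measurableType d) (T' : measurableType d')
    (P' : probability T' R) (P : probability T R) (Z : int -> T' -> R) (Y : nat -> T -> R)
    (m : int) : stationary P' Z -> same_law P' P (fun n : nat => Z n%:Z) Y ->
  same_law P' P (fun n : nat => Z (n%:Z + m)) Y.
Proof.
move=> sZ ZY A cA; rewrite -ZY//.
apply: (sZ m [set x : int -> R | A (fun n : nat => x n%:Z)]).
have : sigma_gen (fun (n : nat) (x : int -> R) => x n%:Z) setT
    (path_event (fun (n : nat) (x : int -> R) => x n%:Z) A).
  exact: path_event_sigma_gen.
by apply: sigma_gen_reindex => n _; exists n%:Z.
Qed.

(** * Mixing of the fractional parts *)

Lemma measurable_frac_part (R : realType) :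
  measurable_fun setT (@frac_part R : measurableTypeR R -> measurableTypeR R).
Proof.
apply: measurable_funB => //; apply: nondecreasing_measurable => // x y xy.
by rewrite ler_int; exact: le_floor.
Qed.

Lemma frac_partD1 (R : realType) (x : R) : frac_part (x + 1) = frac_part x.
Proof. by rewrite /frac_part floorDrz// ?floor1 ?intrD ?intrD1; ring. Qed.

Section frac_walk.
Local Open Scope ereal_scope.
Context (R : realType) d (T : measurableType d) (P : probability T R).
Local Notation mR := (measurableTypeR R).
Context (h : R) (V gamma : nat -> T -> mR) (K : R.-pker mR ~> mR).
Hypothesis h0 : (0 < h)%R.
Hypothesis mV : forall n, measurable_fun setT (V n).
Hypothesis mgamma : forall n, measurable_fun setT (gamma n).
Hypothesis gammaS : forall n w, gamma n.+1 w = (gamma n w + h * V n w)%R.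
Hypothesis indep : indep_of_process P (gamma 0%N) V.
Hypothesis mc : markov_chain P V K.
Hypothesis rK : regenerative K.

Lemma frac_walk_mixing : exists C r : R, [/\ (0 <= C)%R, (0 < r < 1)%R &
  forall n k (A B : set T),
    sigma_gen (fun n w => frac_part (gamma n w)) `I_n.+2 A ->
    sigma_gen (fun n w => frac_part (gamma n w)) [set i | (n + k < i)%N] B ->
    `|P (A `&` B) - P A * P B| <= (C * r ^+ k)%:E * P A].
Proof.
have [a [b [c [d0 [M [ab c0 KJ d00 LMJ]]]]]] := rK.
have t0 : (0 < h^-1)%R by rewrite invr_gt0.
have [C [r [C0 r01 osc]]] := walk_iter_oscillation ab c0 KJ d00 LMJ t0.
exists C, r; split => //.
(* After division by [h] the increments are exactly [V n], and the observable [phi] has period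
   [h^-1]. *)
pose X n w : mR := (gamma n w / h)%R.
pose phi (x : mR) : mR := frac_part (h * x)%R.
have hN0 : h != 0%R by exact: lt0r_neq0.
have PhiE : (fun n w => frac_part (gamma n w)) = (fun n w => phi (X n w)).
  by apply/funext => n; apply/funext => w; rewrite /phi /X mulrC divfK.
have mX n : measurable_fun setT (X n) by exact: (measurable_funM (mgamma n) (measurable_cst _)).
have XS n w : X n.+1 w = (X n w + V n w)%R.
  by rewrite /X gammaS mulrDl mulrAC divff// mul1r.
have mphi : measurable_fun setT phi.
  by apply: (measurableT_comp (@measurable_frac_part R)); exact: measurable_funM.
have phit x : phi (x + h^-1)%R = phi x.
  by rewrite /phi mulrDr divff// frac_partD1.
have indepX : indep_of_process P (X 0%N) V.
  move=> B A mB cA.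
  have -> : X 0%N @^-1` B = gamma 0%N @^-1` [set y : mR | B (y / h)%R] by [].
  apply: indep => //; rewrite -[X in measurable X]setTI.
  have : measurable_fun setT (fun y : mR => (y / h)%R : mR) by exact: measurable_funM.
  exact.
have markov n E (A : set mR) := markov_chain_start (n := n) (E := E) (A := A) (mX 0%N) mV indepX mc.
have oscillation (f : mR * mR -> \bar R) (k : nat) : unit_periodic h^-1 f ->
    exists l u : R, [/\ (0 <= l)%R, (u - l <= C * r ^+ k)%R &
    forall z, l%:E <= iter k (walk_step K) f z <= u%:E].
  by move=> [mf f01 ft]; exact: osc.
move=> n k A B FA FB; rewrite PhiE in FA FB.
apply: (walk_phi_mixing mX mV XS markov mphi phit oscillation) FB.
apply: sigma_gen_sub FA => [|j D jn mD]; first exact: sigma_gen_sigma_algebra.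
have mD' : measurable (phi @^-1` D) by rewrite -[X in measurable X]setTI; exact: mphi.
exact: (walk_adapted XS (m := n.+1) (n := j) (B := phi @^-1` D)).
Qed.

End frac_walk.

Theorem propositionE1 (R : realType) (d d' : measure_display)
    (T : measurableType d) (P : probability T R)
    (T' : measurableType d') (P' : probability T' R)
    (vmin vmax h : R) (V gamma : nat -> {RV P >-> R})
    (Z : int -> {RV P' >-> R})
    (vmin_gt0 : 0 < vmin) (vmin_lt_vmax : vmin < vmax) (h_gt0 : 0 < h)
    (gamma0_indep : indep_of_process P (gamma 0%N) V)
    (gammaS : forall n w, gamma n.+1 w = gamma n w + h * V n w)
    (modelV : model1 V \/ model2 vmin vmax V)
    (Z_stationary : stationary P' Z)
    (Z_extends : same_law P' P (fun n : nat => Z n%:Z)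
                   (fun n w => frac_part (gamma n w))) :
  exists C r : R, [/\ 0 < r, r < 1 &
    forall k : nat, (beta_mixing P' Z k <= (C * r ^+ k)%:E)%E].
Proof.
have [K mc rK] : exists2 K : R.-pker (measurableTypeR R) ~> (measurableTypeR R),
    markov_chain P V K & regenerative K.
  by case: modelV => [/model1_kernel|/(model2_kernel vmin_lt_vmax)].
have mV n : measurable_fun setT (V n : T -> measurableTypeR R) := measurable_funPT (V n).
have mg n : measurable_fun setT (gamma n : T -> measurableTypeR R) := measurable_funPT (gamma n).
have [C [r [C0 /andP[r0 r1] mix]]] := frac_walk_mixing h_gt0 mV mg gammaS gamma0_indep mc rK.
exists C, r; split => // k.
have Crk : 0 <= C * r ^+ k by rewrite mulr_ge0// exprn_ge0// ltW.
have mZ j : measurable_fun setT (Z j) := measurable_funPT (Z j).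
have mZJ J : sigma_gen Z J `<=` measurable by apply: sigma_gen_measurable => j _.
apply: beta_mixing_le => // A B FA FB.
have mB := mZJ _ _ FB; have mA := mZJ _ _ FA.
(* Past events that read finitely many times; their union is a ring generating the infinite past. *)
pose past (n : nat) := sigma_gen Z [set j : int | - (n.+1)%:Z <= j <= 0].
pose G := \bigcup_n past n.
have spast n : sigma_algebra setT (past n) := sigma_gen_sigma_algebra _ _.
have rG : setring G.
  apply: setring_bigcup_sigma_algebra => // m n mn; apply: sigma_gen_mono => j /= /andP[j1 j2].
  by rewrite j2 andbT (le_trans _ j1)// lerN2 lez_nat.
have GT : G setT by exists 0%N => //; exact: sigma_gen_setT.
apply: (mixing_g_sigma_ring (G := G)) => //; last first.
- apply: sigma_gen_sub FA => [|j D /= j0 mD]; first exact: sigma_algebra_g_sigma_ring.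
  apply: sub_g_sigma_ring; exists `|j|%N => //.
  apply: sigma_gen_preimage => //=; rewrite j0 andbT; lia.
- move=> {FA mA}A [n _ FA].
  (* Time 0 becomes [n.+1]: the past occupies the indices up to [n.+1], and the future starts at
     [n.+1 + k], just beyond [n + k]. *)
  pose Y i := Z (i%:Z - n.+1%:Z).
  have lawY : same_law P' P Y (fun n w => frac_part (gamma n w)).
    by move=> D; exact: (same_law_shift (- n.+1%:Z) Z_stationary Z_extends).
  have YA : sigma_gen Y `I_n.+2 A.
    apply: sigma_gen_reindex FA => j /= /andP[j1 j0];
      exists (absz (j + n.+1%:Z)) => /=; first by lia.
    by rewrite /Y (_ : (absz (j + n.+1%:Z))%:Z - n.+1%:Z = j)//; lia.
  have YB : sigma_gen Y [set i | (n + k < i)%N] B.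
    apply: sigma_gen_reindex FB => j /= jk; exists (absz (j + n.+1%:Z)) => /=; first by lia.
    by rewrite /Y (_ : (absz (j + n.+1%:Z))%:Z - n.+1%:Z = j)//; lia.
  (* As path events, [A], [B] and their intersection have the same probabilities for [Y] as for the
     walk. *)
  have [A0 cA0 AE] := sigma_gen_path_event YA; have [B0 cB0 BE] := sigma_gen_path_event YB.
  pose Phi (n : nat) w := frac_part (gamma n w).
  have := mix n k (path_event Phi A0) (path_event Phi B0)
    (path_event_sigma_gen cA0) (path_event_sigma_gen cB0).
  have cA := sigma_gen_cylinder cA0; have cB := sigma_gen_cylinder cB0.
  have cAB : cylinder_sigma (A0 `&` B0) by exact: sigma_gen_setI.
  have EA : P' A = P (path_event Phi A0) by rewrite AE; exact: lawY.
  have EB : P' B = P (path_event Phi B0) by rewrite BE; exact: lawY.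
  have -> : P' (A `&` B) = P (path_event Phi A0 `&` path_event Phi B0).
    by rewrite AE BE; exact: (lawY _ cAB).
  by rewrite EA EB.
- by move=> D [n _ FD]; exact: mZJ FD.
Qed.
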